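(* For every $\alpha>1$, with $\lambda=\alpha(\alpha-1)/2$, \[ \mathbb E\bigl[e^{-\lambda L^{main}}\,\big|\,\mathbf{COND}\bigr]=n^{-(\alpha-1)/2+o(1)}\qquad(n\to\infty). \]
   Context: For $n$ large let $A=\lfloor\ln^{10}n\rfloor$. Let $\xi_1,\dots,\xi_{2n-2}$ be i.i.d. uniform on $\{-1,+1\}$, $S_t=\sum_{i=1}^t\xi_i$ ($S_0=0$). $\mathbf{COND}$ is the event $\{S_{2A-2}=0\}\cap\{S_{2n-2}=0\}$, and $L^{main}=\sum_{i=2A-1}^{2n-2}S_i^2/i^2$. *)

(* Defs.v *)
From Stdlib Require Import Reals ZArith List Lia Lra.
Import ListNotations.
Open Scope R_scope.

(* All sign sequences (xi_1,...,xi_k) in {-1,+1}^k, each exactly once;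
   the uniform i.i.d. law is the uniform measure on this list. *)
Fixpoint sign_seqs (k : nat) : list (list Z) :=
  match k with
  | O => [ [] ]
  | S k' => flat_map (fun s => [ (1%Z :: s) ; ((-1)%Z :: s) ]) (sign_seqs k')
  end.

Definition Spart (x : list Z) (t : nat) : Z := fold_right Z.add 0%Z (firstn t x).

Definition Acut (n : nat) : nat := Z.to_nat (Int_part (ln (INR n) ^ 10)).

Definition COND (n : nat) (x : list Z) : bool :=
  (Z.eqb (Spart x (2 * Acut n - 2)) 0 && Z.eqb (Spart x (2 * n - 2)) 0)%bool.

Definition Lmain (n : nat) (x : list Z) : R :=
  let a := (2 * Acut n - 1)%nat in
  fold_right Rplus 0
    (map (fun i => IZR (Spart x i) ^ 2 / INR i ^ 2) (seq a (2 * n - 1 - a))).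

Definition cond_exp (n : nat) (lam : R) : R :=
  let good := filter (COND n) (sign_seqs (2 * n - 2)) in
  fold_right Rplus 0 (map (fun x => exp (- lam * Lmain n x)) good)
  / INR (length good).

(* Main.v *)
Require Import Defs.
From Stdlib Require Import Reals ZArith List Lia Lra.
Import ListNotations.
Open Scope R_scope.

(** Put [m = 2n-2], [a = 2A-2] and [c = (alpha-1)/2], so that [lam = c + 2c^2].
    Given [S_a = 0] the walk restarts at time [a], hence the conditional expectation is
    the quotient of a Feynman-Kac weight for the walk from [(a,0)] to [(m,0)] by the
    same weight with [lam = 0].  Both satisfy a backward one-step recursion and are
    squeezed between explicit super- and subsolutions.  For Brownian motion with
    potential [lam x^2 / t^2] the exact solution is [t^c exp (- c x^2 / t)], which
    yields the exponent [c]; near the endpoint [m] the heat kernel yields the common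
    exponent [1/2] of numerator and denominator.

    Upper bound: [cosh y <= exp (y^2/2)] makes every Gaussian a supersolution as soon as
    its width satisfies a Riccati inequality.  Lower bound: on the scale
    [s^2 = O(t)] a Gaussian is a subsolution up to relative errors [O(1/t^2)], and
    subtracting a small constant [eta] and taking the positive part confines the
    comparison to that scale, because the potential damps the constant where [s^2 / t]
    is large.  All losses are [n^{o(1)}], including those from [a], which is
    polylogarithmic in [n]. *)

(** * Elementary inequalities for the hyperbolic functions, the exponential and the logarithm *)

Lemma le_of_deriv_nonneg (f f' : R -> R) :
  (forall x, derivable_pt_lim f x (f' x)) -> (forall x, 0 <= x -> 0 <= f' x) ->
  forall y, 0 <= y -> f 0 <= f y.
Proof.
  intros Hd Hp y [Hy | <-]; [|lra].
  destruct (MVT_cor2 f f' 0 y Hy) as [c [Hc [Hc0 _]]]; [intros; apply Hd|].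
  assert (0 <= f' c) by (apply Hp; lra). nra.
Qed.

Lemma cosh_even x : cosh (- x) = cosh x.
Proof. unfold cosh; rewrite Ropp_involutive; lra. Qed.

Lemma cosh_ge_1 x : 1 <= cosh x.
Proof.
  unfold cosh. rewrite exp_Ropp. pose proof (exp_pos x) as H.
  assert (0 <= (exp x - 1) ^ 2 / exp x)
    by (apply Rmult_le_pos; [apply pow2_ge_0 | left; now apply Rinv_0_lt_compat]).
  replace (exp x + / exp x) with ((exp x - 1) ^ 2 / exp x + 2) by (field; lra). lra.
Qed.

Lemma sinh_ge y : 0 <= y -> y <= sinh y.
Proof.
  intros Hy.
  assert (H := le_of_deriv_nonneg (fun x => sinh x - x) (fun x => cosh x - 1)).
  cut (sinh 0 - 0 <= sinh y - y). { rewrite sinh_0. lra. }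
  apply H; auto.
  - intros x. apply (derivable_pt_lim_minus sinh id); [apply derivable_pt_lim_sinh | apply derivable_pt_lim_id].
  - intros x _. pose proof (cosh_ge_1 x). lra.
Qed.

Lemma half_square_deriv x : derivable_pt_lim (fun y => y ^ 2 / 2) x x.
Proof.
  replace x with (INR 2 * x ^ pred 2 * / 2 + x ^ 2 * 0) at 2 by (simpl; field).
  apply (derivable_pt_lim_mult (fun y => y ^ 2) (fun _ => / 2)).
  - apply derivable_pt_lim_pow.
  - apply derivable_pt_lim_const.
Qed.

Lemma cosh_ge_quadratic y : 1 + y ^ 2 / 2 <= cosh y.
Proof.
  assert (P : forall y, 0 <= y -> 1 + y ^ 2 / 2 <= cosh y).
  { clear y; intros y Hy.
    cut (cosh 0 - 0 ^ 2 / 2 <= cosh y - y ^ 2 / 2). { rewrite cosh_0. lra. }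
    apply (le_of_deriv_nonneg (fun x => cosh x - x ^ 2 / 2) (fun x => sinh x - x)); auto.
    - intros x. apply (derivable_pt_lim_minus cosh (fun x => x ^ 2 / 2));
        [apply derivable_pt_lim_cosh | apply half_square_deriv].
    - intros x Hx. pose proof (sinh_ge x Hx). lra. }
  destruct (Rle_dec 0 y); [now apply P|].
  rewrite <- cosh_even. replace (y ^ 2) with ((- y) ^ 2) by ring. apply P; lra.
Qed.

(** The function [cosh y * exp (- (y ^ 2 / 2))] starts at 1 and decreases on the half-line, because
    [sinh y <= y * cosh y] there; evenness covers negative [y]. *)
Lemma cosh_le_gauss y : cosh y <= exp (y ^ 2 / 2).
Proof.
  assert (Q : forall y, 0 <= y -> 0 <= y * cosh y - sinh y).
  { clear y; intros y Hy.
    cut (0 * cosh 0 - sinh 0 <= y * cosh y - sinh y). { rewrite sinh_0; lra. }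
    apply (le_of_deriv_nonneg (fun x => x * cosh x - sinh x) (fun x => x * sinh x)); auto.
    - intros x. replace (x * sinh x) with (1 * cosh x + x * sinh x - cosh x) by ring.
      apply (derivable_pt_lim_minus (fun x => x * cosh x) sinh); [|apply derivable_pt_lim_sinh].
      apply (derivable_pt_lim_mult id cosh); [apply derivable_pt_lim_id | apply derivable_pt_lim_cosh].
    - intros x Hx. pose proof (sinh_ge x Hx). nra. }
  assert (P : forall y, 0 <= y -> cosh y <= exp (y ^ 2 / 2)).
  { clear y; intros y Hy.
    assert (H : - (cosh 0 * exp (- (0 ^ 2 / 2))) <= - (cosh y * exp (- (y ^ 2 / 2)))).
    { apply (le_of_deriv_nonneg (fun x => - (cosh x * exp (- (x ^ 2 / 2))))
        (fun x => (x * cosh x - sinh x) * exp (- (x ^ 2 / 2)))); auto.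
      - intros x.
        replace ((x * cosh x - sinh x) * exp (- (x ^ 2 / 2)))
          with (- (sinh x * exp (- (x ^ 2 / 2)) + cosh x * (exp (- (x ^ 2 / 2)) * - x))) by ring.
        apply (derivable_pt_lim_opp (fun x => cosh x * exp (- (x ^ 2 / 2)))).
        apply (derivable_pt_lim_mult cosh (fun x => exp (- (x ^ 2 / 2)))).
        + apply derivable_pt_lim_cosh.
        + apply (derivable_pt_lim_comp (fun x => - (x ^ 2 / 2)) exp).
          * apply (derivable_pt_lim_opp (fun x => x ^ 2 / 2)). apply half_square_deriv.
          * apply derivable_pt_lim_exp.
      - intros x Hx. apply Rmult_le_pos; [now apply Q | left; apply exp_pos]. }
    rewrite cosh_0 in H. replace (- (0 ^ 2 / 2)) with 0 in H by (simpl; field).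
    rewrite exp_0, exp_Ropp in H. pose proof (exp_pos (y ^ 2 / 2)) as E.
    apply Rmult_le_reg_r with (/ exp (y ^ 2 / 2)); [now apply Rinv_0_lt_compat|].
    rewrite Rinv_r; lra. }
  destruct (Rle_dec 0 y); [now apply P|].
  rewrite <- cosh_even. replace (y ^ 2) with ((- y) ^ 2) by ring. apply P; lra.
Qed.

Lemma exp_le_inv u : u < 1 -> exp u <= / (1 - u).
Proof.
  intros Hu. pose proof (exp_ineq1_le (- u)) as H. rewrite exp_Ropp in H.
  rewrite <- (Rinv_inv (exp u)). apply Rinv_le_contravar; lra.
Qed.

(** With [x = y ^ 2 / 2] this is the chain [cosh y >= 1 + x >= exp (x / (1 + x)) >= exp (x - x ^
    2)]; the error is only quartic in [y]. *)
Lemma cosh_ge_gauss y : exp (y ^ 2 / 2 - y ^ 4 / 4) <= cosh y.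
Proof.
  apply Rle_trans with (1 + y ^ 2 / 2); [|apply cosh_ge_quadratic].
  set (x := y ^ 2 / 2). assert (Hx : 0 <= x) by (unfold x; nra).
  replace (y ^ 4 / 4) with (x ^ 2) by (unfold x; field).
  apply Rle_trans with (exp (x / (1 + x))).
  - assert (H : x - x ^ 2 <= x / (1 + x)).
    { apply Rmult_le_reg_r with (1 + x); [lra|]. unfold Rdiv.
      rewrite Rmult_assoc, Rinv_l; nra. }
    destruct H as [H | ->]; [left; now apply exp_increasing | lra].
  - replace (1 + x) with (/ (1 - x / (1 + x))) at 2 by (field; lra).
    apply exp_le_inv. apply Rmult_lt_reg_r with (1 + x); [lra|]. unfold Rdiv.
    rewrite Rmult_assoc, Rinv_l; lra.
Qed.

Lemma exp_le x y : x <= y -> exp x <= exp y.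
Proof. intros [H | ->]; [left; now apply exp_increasing | lra]. Qed.

Lemma exp_nonpos x : x <= 0 -> exp x <= 1.
Proof. rewrite <- exp_0. apply exp_le. Qed.

Lemma ln_le_compat x y : 0 < x -> x <= y -> ln x <= ln y.
Proof. intros Hx [H | ->]; [left; now apply ln_increasing | lra]. Qed.

Lemma ln_quot x y : 0 < x -> 0 < y -> ln (x / y) = ln x - ln y.
Proof.
  intros Hx Hy. unfold Rdiv. rewrite ln_mult, ln_Rinv; auto with real.
Qed.

Lemma ln_succ_le x : 0 < x -> ln (x + 1) - ln x <= / x.
Proof.
  intros Hx. rewrite <- (ln_exp (/ x)), <- ln_quot by lra.
  apply ln_le_compat; [apply Rdiv_lt_0_compat; lra|].
  replace ((x + 1) / x) with (1 + / x) by (field; lra). apply exp_ineq1_le.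
Qed.

Lemma ln_succ_ge x : 0 < x -> / (x + 1) <= ln (x + 1) - ln x.
Proof.
  intros Hx. rewrite <- (ln_exp (/ (x + 1))), <- ln_quot by lra.
  apply ln_le_compat; [apply exp_pos|].
  replace ((x + 1) / x) with (/ (1 - / (x + 1))) by (field; lra). apply exp_le_inv.
  rewrite <- Rinv_1 at 2. apply Rinv_lt_contravar; lra.
Qed.

(** * One-step averages of Gaussians *)

Lemma gauss_average G s :
  (exp (- G * (s + 1) ^ 2) + exp (- G * (s - 1) ^ 2)) / 2
  = exp (- G * (s ^ 2 + 1)) * cosh (2 * G * s).
Proof.
  unfold cosh.
  replace (- G * (s + 1) ^ 2) with (- G * (s ^ 2 + 1) + - (2 * G * s)) by ring.
  replace (- G * (s - 1) ^ 2) with (- G * (s ^ 2 + 1) + 2 * G * s) by ring.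
  rewrite !exp_plus. field.
Qed.

(** A discrete heat step acts on Gaussian exponents by the Riccati map [G - 2 * G ^ 2] and costs the
    factor [exp (- G)]; the upper bound has no error term. *)
Lemma gauss_average_le G s :
  (exp (- G * (s + 1) ^ 2) + exp (- G * (s - 1) ^ 2)) / 2
  <= exp (- G - (G - 2 * G ^ 2) * s ^ 2).
Proof.
  rewrite gauss_average.
  apply Rle_trans with (exp (- G * (s ^ 2 + 1)) * exp ((2 * G * s) ^ 2 / 2)).
  - apply Rmult_le_compat_l; [left; apply exp_pos | apply cosh_le_gauss].
  - rewrite <- exp_plus. apply exp_le. right; field.
Qed.

(** Same Riccati map as in the upper bound. For [G] of order [1 / t] and [s ^ 2] of order [t] the
    quartic correction is of order [1 / t ^ 2], hence summable over time. *)
Lemma gauss_average_ge G s :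
  exp (- G - (G - 2 * G ^ 2) * s ^ 2 - 4 * G ^ 4 * s ^ 4)
  <= (exp (- G * (s + 1) ^ 2) + exp (- G * (s - 1) ^ 2)) / 2.
Proof.
  rewrite gauss_average.
  apply Rle_trans with (exp (- G * (s ^ 2 + 1)) * exp ((2 * G * s) ^ 2 / 2 - (2 * G * s) ^ 4 / 4)).
  - rewrite <- exp_plus. apply exp_le. right; field.
  - apply Rmult_le_compat_l; [left; apply exp_pos | apply cosh_ge_gauss].
Qed.

(** * The weighted bridge and Gaussian supersolutions *)

(* [k] is the number of remaining steps, and [p k] the potential felt after the step
   that leaves [k] of them. *)
Fixpoint bridge (p : nat -> R) (k : nat) (s : Z) : R :=
  match k with
  | O => if Z.eqb s 0 then 1 else 0
  | S k' => (exp (- p k' * IZR (s + 1) ^ 2) * bridge p k' (s + 1)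
             + exp (- p k' * IZR (s - 1) ^ 2) * bridge p k' (s - 1)) / 2
  end.

Lemma bridge_nonneg p k s : 0 <= bridge p k s.
Proof.
  revert s; induction k as [|k IH]; intros s; simpl.
  - destruct (Z.eqb s 0); lra.
  - pose proof (Rmult_le_pos _ _ (Rlt_le _ _ (exp_pos (- p k * (IZR (s + 1) * (IZR (s + 1) * 1))))) (IH (s + 1)%Z)).
    pose proof (Rmult_le_pos _ _ (Rlt_le _ _ (exp_pos (- p k * (IZR (s - 1) * (IZR (s - 1) * 1))))) (IH (s - 1)%Z)).
    lra.
Qed.

(** The Gaussian first absorbs the potential, which gives the exponent [G], and is then averaged
    over the two neighbours. Inequalities instead of equations leave room for exponents in closed
    form. *)
Lemma bridge_upper_step p k C g g' G :
  0 <= C -> (forall s, bridge p k s <= C * exp (- g * IZR s ^ 2)) ->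
  G <= g + p k -> g' <= G - 2 * G ^ 2 ->
  forall s, bridge p (S k) s <= C * exp (- G) * exp (- g' * IZR s ^ 2).
Proof.
  intros HC H HG Hg s.
  assert (T : forall x : Z, exp (- p k * IZR x ^ 2) * bridge p k x <= C * exp (- G * IZR x ^ 2)).
  { intros x. apply Rle_trans with (exp (- p k * IZR x ^ 2) * (C * exp (- g * IZR x ^ 2))).
    - apply Rmult_le_compat_l; [left; apply exp_pos | apply H].
    - replace (exp (- p k * IZR x ^ 2) * (C * exp (- g * IZR x ^ 2)))
        with (C * (exp (- p k * IZR x ^ 2) * exp (- g * IZR x ^ 2))) by ring.
      rewrite <- exp_plus. apply Rmult_le_compat_l; auto.
      apply exp_le. pose proof (pow2_ge_0 (IZR x)). nra. }
  pose proof (T (s + 1)%Z) as T1. pose proof (T (s - 1)%Z) as T2.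
  cbn [bridge].
  apply Rle_trans with
    (C * ((exp (- G * IZR (s + 1) ^ 2) + exp (- G * IZR (s - 1) ^ 2)) / 2)); [lra|].
  rewrite Rmult_assoc. apply Rmult_le_compat_l; auto.
  rewrite plus_IZR, minus_IZR. eapply Rle_trans; [apply gauss_average_le|].
  rewrite <- exp_plus. apply exp_le. pose proof (pow2_ge_0 (IZR s)). nra.
Qed.

(** The supersolution is a heat kernel with exponent [th] below 1/2 and time shifted by [K]. The
    condition linking [th] and [K] is the Riccati inequality from [th / x] to [th / (x + 1)] at
    [x = K], and it persists for larger [x]. *)
Lemma bridge_upper_free p k th K :
  0 <= th -> 0 < K -> 2 * th * (K + 1) <= K -> (forall j, (j < k)%nat -> 0 <= p j) ->
  forall s, bridge p k s
    <= exp (- th * (ln (INR k + K) - ln K)) * exp (- (th / (INR k + K)) * IZR s ^ 2).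
Proof.
  intros Hth HK HthK. induction k as [|k IH]; intros Hp s.
  - simpl INR. rewrite Rplus_0_l, Rminus_diag, Rmult_0_r, exp_0, Rmult_1_l. simpl bridge.
    destruct (Z.eqb_spec s 0) as [-> | _]; [|left; apply exp_pos].
    replace (- (th / K) * 0 ^ 2) with 0 by ring. rewrite exp_0; lra.
  - set (x := INR k + K).
    assert (Hx : K <= x) by (unfold x; pose proof (pos_INR k); lra).
    replace (INR (S k) + K) with (x + 1) by (rewrite S_INR; unfold x; ring).
    eapply Rle_trans.
    + eapply (bridge_upper_step p k _ (th / x) (th / (x + 1)) (th / x)).
      * apply Rlt_le, exp_pos.
      * apply IH. intros; apply Hp; lia.
      * specialize (Hp k ltac:(lia)); lra.
      * assert (E : th / x - 2 * (th / x) ^ 2 - th / (x + 1)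
          = th * (x - 2 * th * (x + 1)) / (x ^ 2 * (x + 1))) by (field; lra).
        assert (0 <= th * (x - 2 * th * (x + 1)) / (x ^ 2 * (x + 1))); [|lra].
        apply Rmult_le_pos; [|left; apply Rinv_0_lt_compat; nra].
        apply Rmult_le_pos; [lra|].
        assert (2 * th <= 1) by nra. nra.
    + apply Rmult_le_compat_r; [left; apply exp_pos|].
      rewrite <- exp_plus. apply exp_le. fold x.
      pose proof (ln_succ_le x ltac:(lra)). unfold Rdiv. nra.
Qed.

(* With [k] of [m] steps remaining, the time is [m - k]. *)
Definition invsq (lam : R) (m k : nat) : R := lam / INR (m - k) ^ 2.

(** Going backward from time [M], the Gaussian exponent at time [j] is [c * (1/j - 1/M)]. It
    vanishes at [M], so a bound uniform in [s] suffices to start, and it is close to [c / j] for [j]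
    far below [M]. *)
Lemma bridge_upper_potential lam c mu C m M i :
  0 <= c -> 0 <= C -> 0 < mu -> 0 < lam ->
  (1 <= i)%nat -> (i <= M)%nat -> (M <= m)%nat ->
  2 * (c + mu / INR i) ^ 2 <= mu -> (c + mu) * (1 + / INR i) ^ 2 <= lam ->
  (forall s, bridge (invsq lam m) (m - M) s <= C) ->
  forall s, bridge (invsq lam m) (m - i) s
    <= C * exp (- c * (ln (INR M) - ln (INR i)) + c)
         * exp (- (c * (/ INR i - / INR M)) * IZR s ^ 2).
Proof.
  intros Hc HC Hmu Hlam Hi HiM HMm H1 H2 HV.
  (* The term [- 1/M] in the Gaussian exponent costs [c / INR M] per step compared with the
     logarithm; over all steps this adds up to at most [c]. *)
  cut (forall d, (d <= M - i)%nat -> forall s,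
    bridge (invsq lam m) (m - (M - d)) s
    <= C * exp (- c * (ln (INR M) - ln (INR (M - d))) + c * (INR d / INR M))
         * exp (- (c * (/ INR (M - d) - / INR M)) * IZR s ^ 2)).
  { intros HH s. specialize (HH (M - i)%nat ltac:(lia) s).
    replace (M - (M - i))%nat with i in HH by lia.
    eapply Rle_trans; [exact HH|]. apply Rmult_le_compat_r; [left; apply exp_pos|].
    apply Rmult_le_compat_l; auto. apply exp_le. apply Rplus_le_compat_l.
    rewrite <- (Rmult_1_r c) at 2. apply Rmult_le_compat_l; auto.
    assert (0 < INR M) by (apply lt_0_INR; lia).
    apply Rmult_le_reg_r with (INR M); auto. unfold Rdiv. rewrite Rmult_assoc, Rinv_l by lra.
    rewrite Rmult_1_r, Rmult_1_l. apply le_INR; lia. }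
  induction d as [|d IH]; intros Hd s.
  - rewrite Nat.sub_0_r. simpl INR. eapply Rle_trans; [apply HV|].
    replace (- c * (ln (INR M) - ln (INR M)) + c * (0 / INR M)) with 0 by (unfold Rdiv; ring).
    replace (- (c * (/ INR M - / INR M)) * IZR s ^ 2) with 0 by ring. rewrite exp_0; lra.
  - set (j := (M - S d)%nat). assert (Hj : (i <= j)%nat) by (unfold j; lia).
    assert (Ej : (M - d)%nat = S j) by (unfold j; lia).
    replace (m - j)%nat with (S (m - (M - d))) by lia.
    assert (HiR : 1 <= INR i) by (apply (le_INR 1); lia).
    assert (HjR : INR i <= INR j) by (now apply le_INR).
    assert (HjM : INR j <= INR M) by (apply le_INR; lia).
    set (x := INR j) in *.
    assert (Ex : INR (M - d) = x + 1) by (rewrite Ej, S_INR; reflexivity).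
    assert (Hinv : / INR M <= / x) by (apply Rinv_le_contravar; lra).
    assert (HinvM : 0 < / INR M) by (apply Rinv_0_lt_compat; lra).
    assert (Hix : / x <= / INR i) by (apply Rinv_le_contravar; lra).
    assert (Hx0 : 0 < / x) by (apply Rinv_0_lt_compat; lra).
    (* The potential at [x + 1] pays for two things: the growth of the exponent from time [x + 1] to
       [x], and the reserve [mu / x ^ 2], which covers the quadratic Riccati loss [2 * G ^ 2]. *)
    set (G := c * (/ x - / INR M) + mu / x ^ 2).
    assert (Hq : mu / x ^ 2 = mu * / x * / x) by (field; lra).
    eapply Rle_trans.
    + eapply (bridge_upper_step _ _
               (C * exp (- c * (ln (INR M) - ln (INR (M - d))) + c * (INR d / INR M)))
               (c * (/ INR (M - d) - / INR M))
               (c * (/ x - / INR M)) G).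
      * apply Rmult_le_pos; [auto | left; apply exp_pos].
      * apply IH; lia.
      * unfold invsq. replace (m - (m - (M - d)))%nat with (M - d)%nat by lia.
        rewrite Ex. unfold G.
        assert (E : c / (x * (x + 1)) + mu / x ^ 2 <= lam / (x + 1) ^ 2).
        { apply Rle_trans with ((c + mu) / x ^ 2).
          - assert (c / (x * (x + 1)) <= c / x ^ 2).
            { apply Rmult_le_compat_l; auto. apply Rinv_le_contravar; nra. }
            unfold Rdiv in *. lra.
          - apply Rmult_le_reg_r with ((x + 1) ^ 2); [nra|].
            replace (lam / (x + 1) ^ 2 * (x + 1) ^ 2) with lam by (field; lra).
            replace ((c + mu) / x ^ 2 * (x + 1) ^ 2) with ((c + mu) * (1 + / x) ^ 2)
              by (field; lra).
            eapply Rle_trans; [|exact H2]. apply Rmult_le_compat_l; [lra|].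
            apply pow_incr; lra. }
        assert (c / (x * (x + 1)) = c * / x - c * / (x + 1)) by (field; lra).
        lra.
      * assert (2 * G ^ 2 <= mu / x ^ 2); [|unfold G at 1; lra].
        assert (0 <= G). { unfold G; rewrite Hq.
          assert (0 <= c * (/ x - / INR M)) by (apply Rmult_le_pos; lra).
          assert (0 <= mu * / x * / x) by (apply Rmult_le_pos; [apply Rmult_le_pos|]; lra). lra. }
        assert (G <= (c + mu / INR i) * / x).
        { unfold G. rewrite Hq. unfold Rdiv.
          assert (c * (/ x - / INR M) <= c * / x) by (apply Rmult_le_compat_l; lra).
          assert (mu * / x * / x <= mu * / INR i * / x).
          { apply Rmult_le_compat_r; [lra|]. apply Rmult_le_compat_l; lra. }
          lra. }
        apply Rle_trans with (2 * ((c + mu / INR i) * / x) ^ 2).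
        -- apply Rmult_le_compat_l; [lra|]. apply pow_incr; lra.
        -- replace (2 * ((c + mu / INR i) * / x) ^ 2)
             with (2 * (c + mu / INR i) ^ 2 * (/ x * / x)) by ring.
           rewrite Hq, (Rmult_assoc mu). apply Rmult_le_compat_r; [nra|exact H1].
    + apply Rmult_le_compat_r; [left; apply exp_pos|].
      rewrite Rmult_assoc. apply Rmult_le_compat_l; auto.
      rewrite <- exp_plus. apply exp_le. rewrite Ex, S_INR.
      pose proof (ln_succ_le x ltac:(lra)) as L.
      assert (0 <= mu / x ^ 2) by (rewrite Hq; apply Rmult_le_pos; [apply Rmult_le_pos|]; lra).
      assert (c * (ln (x + 1) - ln x) <= c * / x) by (apply Rmult_le_compat_l; lra).
      unfold G, Rdiv in *. lra.
Qed.

(** * Truncated Gaussian subsolutions *)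

(** One backward step for a Gaussian minus [eta], with potential [q / x ^ 2]. The slack [d] in the
    decay rate [(gam + d) / x] has to absorb the quartic error of the Gaussian and the cost of the
    constant. The threshold [X0] may depend on [eta], since a smaller [eta] admits larger [s]. *)
Lemma truncated_gauss_average gam q d : 0 < gam -> 0 < q -> 0 < d ->
  exists eta0, 0 < eta0 < 1 /\ forall eta, 0 < eta <= eta0 ->
  exists X0, 1 <= X0 /\ forall x g' s, X0 <= x -> gam / (2 * x) <= g' <= 2 * gam / x ->
  (gam / x + q / x ^ 2) - 2 * (gam / x + q / x ^ 2) ^ 2 <= g' ->
  eta <= exp (- g' * s ^ 2) ->
  exp (- (gam + d) / x) * (exp (- g' * s ^ 2) - eta)
  <= (exp (- (q / x ^ 2) * (s + 1) ^ 2) * (exp (- (gam / x) * (s + 1) ^ 2) - eta)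
      + exp (- (q / x ^ 2) * (s - 1) ^ 2) * (exp (- (gam / x) * (s - 1) ^ 2) - eta)) / 2.
Proof.
  (* From [s ^ 2 = z0 * x] on, half of the potential term, [q / (2 * x ^ 2) * s ^ 2], is at least
     [b / x], the rate at which the prefactor decays. *)
  intros Hgam Hq Hd. set (b := gam + d). set (z0 := 2 * b / q).
  assert (Hb : 0 < b) by (unfold b; lra).
  assert (Hz0 : 0 < z0) by (apply Rdiv_lt_0_compat; lra).
  set (e0 := d * exp (- (2 * gam * z0)) / (4 * b)).
  assert (He0 : 0 < e0).
  { apply Rdiv_lt_0_compat; [|lra]. apply Rmult_lt_0_compat; [lra | apply exp_pos]. }
  exists (Rmin (1 / 2) e0). split.
  { split; [apply Rmin_glb_lt; lra|]. pose proof (Rmin_l (1 / 2) e0). lra. }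
  intros eta [Heta Heta0].
  assert (Hee : eta <= e0) by (pose proof (Rmin_r (1 / 2) e0); lra).
  assert (He1 : eta <= 1 / 2) by (pose proof (Rmin_l (1 / 2) e0); lra).
  clear Heta0.
  (* The assumption that the new Gaussian is at least [eta], together with [g' >= gam / (2 * x)],
     confines [s ^ 2] to at most [R * x]. [W] then collects all errors of order [1 / x ^ 2]. *)
  set (R := 2 * (- ln eta) / gam).
  assert (Hln : ln eta < 0) by (rewrite <- ln_1; apply ln_increasing; lra).
  assert (HR : 0 <= R) by (left; apply Rdiv_lt_0_compat; lra).
  set (W := q + 64 * gam ^ 4 * R ^ 2).
  assert (Hg4 : 0 < gam ^ 4) by (apply pow_lt; lra).
  assert (HW : q <= W).
  { unfold W. pose proof (Rmult_le_pos _ _ (Rlt_le _ _ Hg4) (pow2_ge_0 R)). lra. }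
  (* The summands ensure, in order: [x >= 1], [G <= 2 * gam / x], [b / x <= 1 / 2],
     [W / x <= d / 2], and [p <= 1 / 4]. *)
  exists (1 + q / gam + 2 * b + 2 * W / d + 4 * q).
  assert (H1 : 0 < q / gam) by (apply Rdiv_lt_0_compat; lra).
  assert (H2 : 0 < 2 * W / d) by (apply Rdiv_lt_0_compat; lra).
  split; [lra|].
  intros x g' s Hx [Hg'l Hg'u] HG Hs.
  assert (Hx1 : 1 <= x) by lra.
  set (y := / x). assert (Hy : 0 < y) by (apply Rinv_0_lt_compat; lra).
  assert (Exy : x * y = 1) by (apply Rinv_r; lra).
  set (p := q / x ^ 2) in *. assert (Ep : p = q * y ^ 2) by (unfold p, y; field; lra).
  assert (Egx : gam / x = gam * y) by reflexivity.
  set (G := gam / x + p) in *.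
  assert (HG0 : 0 < G) by (unfold G; rewrite Ep, Egx; nra).
  assert (Hqy : q * y <= gam).
  { apply Rmult_le_reg_r with x; [lra|]. rewrite Rmult_assoc, (Rmult_comm y), Exy, Rmult_1_r.
    apply Rmult_le_reg_l with (/ gam); [now apply Rinv_0_lt_compat|].
    rewrite <- Rmult_assoc, Rinv_l by lra. unfold Rdiv in H1, Hx. lra. }
  assert (HGu : G <= 2 * gam * y) by (unfold G; rewrite Ep, Egx; nra).
  assert (Hs2 : s ^ 2 <= R * x).
  { assert (g' * s ^ 2 <= - ln eta).
    { cut (ln eta <= - g' * s ^ 2); [lra|]. rewrite <- (ln_exp (- g' * s ^ 2)).
      now apply ln_le_compat. }
    assert (gam / (2 * x) * s ^ 2 <= - ln eta).
    { eapply Rle_trans; [|eassumption]. apply Rmult_le_compat_r; [apply pow2_ge_0 | exact Hg'l]. }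
    replace (s ^ 2) with (2 * x / gam * (gam / (2 * x) * s ^ 2)) by (field; lra).
    replace (R * x) with (2 * x / gam * (- ln eta)) by (unfold R; field; lra).
    apply Rmult_le_compat_l; [left; apply Rdiv_lt_0_compat; lra | assumption]. }
  assert (HG4 : 4 * G ^ 4 * s ^ 4 <= 64 * gam ^ 4 * R ^ 2 * y ^ 2).
  { apply Rle_trans with (4 * (2 * gam * y) ^ 4 * (R * x) ^ 2).
    - replace (s ^ 4) with ((s ^ 2) ^ 2) by ring.
      apply Rmult_le_compat; [| apply pow2_ge_0 | |].
      + pose proof (pow_lt G 4 HG0). lra.
      + apply Rmult_le_compat_l; [lra|]. apply pow_incr; lra.
      + apply pow_incr; split; [apply pow2_ge_0 | assumption].
    - right. replace (4 * (2 * gam * y) ^ 4 * (R * x) ^ 2)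
        with (64 * gam ^ 4 * R ^ 2 * y ^ 2 * (x * y) ^ 2) by ring. rewrite Exy. ring. }
  (* [D1] and, below, [D2] are the logarithmic gains of the Gaussian part and of the constant part
     relative to the common factor [exp (- b / x)]. *)
  set (D1 := b * y - G - 4 * G ^ 4 * s ^ 4).
  assert (HWy : W * y <= d / 2).
  { apply Rmult_le_reg_r with x; [lra|]. rewrite Rmult_assoc, (Rmult_comm y), Exy, Rmult_1_r.
    apply Rmult_le_reg_l with (2 / d); [apply Rdiv_lt_0_compat; lra|].
    replace (2 / d * (d / 2 * x)) with x by (field; lra). unfold Rdiv in *. lra. }
  assert (HD1 : d * y / 2 <= D1).
  { unfold D1, G. rewrite Ep, Egx.
    assert (W * y ^ 2 <= d / 2 * y) by (replace (W * y ^ 2) with (W * y * y) by ring; apply Rmult_le_compat_r; lra).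
    unfold W in *. unfold G in HG4. rewrite Ep, Egx in HG4. unfold b. lra. }
  assert (Hp4 : p <= 1 / 4).
  { rewrite Ep. assert (4 * q * y <= 1).
    { apply Rmult_le_reg_r with x; [lra|]. rewrite Rmult_assoc, (Rmult_comm y), Exy. lra. }
    assert (y <= 1). { apply Rmult_le_reg_r with x; [lra|]. rewrite (Rmult_comm y), Exy. lra. }
    nra. }
  assert (Hp0 : 0 < p) by (rewrite Ep; apply Rmult_lt_0_compat; [lra | apply pow_lt; lra]).
  set (D2 := b * y - p - (p - 2 * p ^ 2) * s ^ 2).
  set (E := exp (- g' * s ^ 2)) in *.
  assert (HE : 0 < E) by apply exp_pos.
  assert (S1 : exp (- (b * y)) * exp D1 * E
     <= (exp (- G * (s + 1) ^ 2) + exp (- G * (s - 1) ^ 2)) / 2).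
  { eapply Rle_trans; [|apply gauss_average_ge]. unfold E. rewrite <- !exp_plus.
    apply exp_le. unfold D1. pose proof (pow2_ge_0 s). nra. }
  assert (S2 : (exp (- p * (s + 1) ^ 2) + exp (- p * (s - 1) ^ 2)) / 2
     <= exp (- (b * y)) * exp D2).
  { eapply Rle_trans; [apply gauss_average_le|]. rewrite <- exp_plus.
    apply exp_le. unfold D2. lra. }
  assert (Key : E - eta <= exp D1 * E - eta * exp D2).
  { pose proof (exp_ineq1_le D1) as I1.
    assert (0 < d * y) by (apply Rmult_lt_0_compat; lra).
    pose proof (pow2_ge_0 s).
    assert (Hpp : p / 2 * s ^ 2 <= (p - 2 * p ^ 2) * s ^ 2)
      by (apply Rmult_le_compat_r; [assumption | nra]).
    (* Far out, the potential alone makes [D2 <= 0]. Closer in, [E] is bounded below by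
       [exp (- (2 * gam * z0))], and [e0] was chosen so that the gain [d * y / 2 * E] covers the
       growth [eta * (2 * (b * y))] of the constant. *)
    destruct (Rle_dec (z0 * x) (s ^ 2)) as [Hz | Hz].
    - assert (D2 <= 0).
      { unfold D2. assert (p / 2 * (z0 * x) <= p / 2 * s ^ 2)
          by (apply Rmult_le_compat_l; lra).
        assert (p / 2 * (z0 * x) = b * y) by (unfold p, z0, y; field; lra). lra. }
      assert (exp D2 <= 1) by (rewrite <- exp_0; now apply exp_le).
      nra.
    - assert (HEl : exp (- (2 * gam * z0)) <= E).
      { apply exp_le. assert (g' * s ^ 2 <= 2 * gam / x * (z0 * x)).
        { apply Rmult_le_compat; try lra. apply Rle_trans with (gam / (2 * x)); auto.
          left; apply Rdiv_lt_0_compat; lra. }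
        replace (2 * gam / x * (z0 * x)) with (2 * gam * z0) in H3 by (field; lra). lra. }
      assert (Hby : b * y <= 1 / 2).
      { apply Rmult_le_reg_r with x; [lra|]. rewrite Rmult_assoc, (Rmult_comm y), Exy. lra. }
      assert (I2 : exp D2 <= 1 + 2 * (b * y)).
      { apply Rle_trans with (exp (b * y)).
        - apply exp_le. unfold D2. assert (0 <= p / 2 * s ^ 2) by (apply Rmult_le_pos; lra). lra.
        - assert (0 < b * y) by (apply Rmult_lt_0_compat; lra).
          eapply Rle_trans; [apply exp_le_inv; lra|].
          apply Rmult_le_reg_r with (1 - b * y); [lra|]. rewrite Rinv_l by lra. nra. }
      assert (I3 : eta * (2 * (b * y)) <= d * y / 2 * E).
      { apply Rle_trans with (e0 * (2 * (b * y))).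
        - apply Rmult_le_compat_r; [|assumption].
          assert (0 < b * y) by (apply Rmult_lt_0_compat; lra). lra.
        - replace (e0 * (2 * (b * y))) with (d * y / 2 * exp (- (2 * gam * z0)))
            by (unfold e0; field; lra).
          apply Rmult_le_compat_l; lra. }
      assert (d * y / 2 * E <= (exp D1 - 1) * E) by (apply Rmult_le_compat_r; lra).
      assert (eta * exp D2 <= eta * (1 + 2 * (b * y))) by (apply Rmult_le_compat_l; lra).
      lra. }
  assert (Ecomb : forall t, exp (- p * t ^ 2) * (exp (- (gam / x) * t ^ 2) - eta)
      = exp (- G * t ^ 2) - eta * exp (- p * t ^ 2)).
  { intros t. rewrite Rmult_minus_distr_l, <- exp_plus.
    replace (- p * t ^ 2 + - (gam / x) * t ^ 2) with (- G * t ^ 2) by (unfold G; ring). ring. }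
  rewrite !Ecomb.
  replace (- b / x) with (- (b * y)) by (unfold y; field; lra).
  assert (exp (- (b * y)) * (E - eta) <= exp (- (b * y)) * (exp D1 * E - eta * exp D2))
    by (apply Rmult_le_compat_l; [left; apply exp_pos | assumption]).
  assert (eta * ((exp (- p * (s + 1) ^ 2) + exp (- p * (s - 1) ^ 2)) / 2)
      <= eta * (exp (- (b * y)) * exp D2)) by (apply Rmult_le_compat_l; lra).
  lra.
Qed.

(** Where the Gaussian is below [eta] the claim is trivial by nonnegativity, so the one-step
    inequality is demanded only above that level. The parity condition is needed because [bridge]
    vanishes on sites of the wrong parity. *)
Lemma bridge_lower_step p k P A B g g' eta s :
  0 <= A -> p k <= P ->
  (forall t, Z.even (t + Z.of_nat k) = true ->
     A * (exp (- g * IZR t ^ 2) - eta) <= bridge p k t) ->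
  Z.even (s + Z.of_nat (S k)) = true ->
  (eta <= exp (- g' * IZR s ^ 2) ->
   B * (exp (- g' * IZR s ^ 2) - eta)
   <= (exp (- P * (IZR s + 1) ^ 2) * (exp (- g * (IZR s + 1) ^ 2) - eta)
      + exp (- P * (IZR s - 1) ^ 2) * (exp (- g * (IZR s - 1) ^ 2) - eta)) / 2) ->
  0 <= B -> A * B * (exp (- g' * IZR s ^ 2) - eta) <= bridge p (S k) s.
Proof.
  intros HA HP HV Hs Hstep HB.
  destruct (Rle_dec eta (exp (- g' * IZR s ^ 2))) as [He | He].
  2: { apply Rle_trans with 0; [|apply bridge_nonneg].
       assert (0 <= A * B) by (now apply Rmult_le_pos). nra. }
  specialize (Hstep He).
  assert (T : forall t, Z.even (t + Z.of_nat k) = true ->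
    A * (exp (- P * IZR t ^ 2) * (exp (- g * IZR t ^ 2) - eta))
    <= exp (- p k * IZR t ^ 2) * bridge p k t).
  { intros t Ht. specialize (HV t Ht). pose proof (bridge_nonneg p k t).
    pose proof (exp_pos (- P * IZR t ^ 2)).
    assert (exp (- P * IZR t ^ 2) <= exp (- p k * IZR t ^ 2)).
    { apply exp_le. pose proof (pow2_ge_0 (IZR t)). nra. }
    apply Rle_trans with (exp (- P * IZR t ^ 2) * bridge p k t).
    - replace (A * (exp (- P * IZR t ^ 2) * (exp (- g * IZR t ^ 2) - eta)))
        with (exp (- P * IZR t ^ 2) * (A * (exp (- g * IZR t ^ 2) - eta))) by ring.
      apply Rmult_le_compat_l; lra.
    - apply Rmult_le_compat_r; lra. }
  pose proof (T (s + 1)%Z) as T1. pose proof (T (s - 1)%Z) as T2.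
  replace (s + 1 + Z.of_nat k)%Z with (s + Z.of_nat (S k))%Z in T1 by lia.
  replace (s - 1 + Z.of_nat k)%Z with (s + Z.of_nat (S k) - 2)%Z in T2 by lia.
  rewrite Z.even_sub, Hs in T2. specialize (T1 Hs). specialize (T2 eq_refl).
  rewrite plus_IZR in T1. rewrite minus_IZR in T2.
  cbn [bridge]. rewrite plus_IZR, minus_IZR.
  apply (Rmult_le_compat_l A) in Hstep; auto. lra.
Qed.

(** A single path suffices: some step always leads to a site no further from 0 than the remaining
    number of steps, and it costs at most the factor [exp (- d) / 2]. *)
Lemma bridge_reach p d k : 0 <= d ->
  (forall j, (j < k)%nat -> 0 <= p j /\ p j * INR j ^ 2 <= d) ->
  forall s, (Z.abs s <= Z.of_nat k)%Z -> Z.even (s + Z.of_nat k) = true ->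
  (exp (- d) / 2) ^ k <= bridge p k s.
Proof.
  intros Hd. induction k as [|k IH]; intros Hp s Hs He.
  - assert (s = 0%Z) by lia. subst. simpl. lra.
  - assert (IH' : forall s, (Z.abs s <= Z.of_nat k)%Z -> Z.even (s + Z.of_nat k) = true ->
      exp (- d) * (exp (- d) / 2) ^ k <= exp (- p k * IZR s ^ 2) * bridge p k s).
    { intros t Ht Het. apply Rmult_le_compat.
      - left; apply exp_pos.
      - apply pow_le. pose proof (exp_pos (- d)). lra.
      - apply exp_le. destruct (Hp k ltac:(lia)) as [Hp0 Hp1].
        assert (IZR t ^ 2 <= INR k ^ 2).
        { rewrite INR_IZR_INZ. rewrite <- (pow2_abs (IZR t)), <- abs_IZR.
          apply pow_incr; split; apply IZR_le; lia. }
        assert (p k * IZR t ^ 2 <= p k * INR k ^ 2) by (now apply Rmult_le_compat_l). lra.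
      - apply IH; auto. }
    assert (N : forall t, 0 <= exp (- p k * IZR t ^ 2) * bridge p k t).
    { intros t. apply Rmult_le_pos; [left; apply exp_pos | apply bridge_nonneg]. }
    cbn [bridge]. rewrite <- tech_pow_Rmult.
    (* At [s = 0] a step away from 0 is admissible as soon as [k >= 1]; parity excludes [k = 0]. *)
    assert (D : (Z.abs (s + 1) <= Z.of_nat k \/ Z.abs (s - 1) <= Z.of_nat k)%Z).
    { destruct (Z.le_gt_cases s 0); [|right; lia].
      destruct (Z.eq_dec s 0) as [-> | ]; [|left; lia].
      destruct k; [discriminate He | left; lia]. }
    destruct D as [D | D].
    + pose proof (N (s - 1)%Z). pose proof (IH' (s + 1)%Z D) as I.
      replace (s + 1 + Z.of_nat k)%Z with (s + Z.of_nat (S k))%Z in I by lia.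
      specialize (I He). lra.
    + pose proof (N (s + 1)%Z). pose proof (IH' (s - 1)%Z D) as I.
      replace (s - 1 + Z.of_nat k)%Z with (s + Z.of_nat (S k) - 2)%Z in I by lia.
      rewrite Z.even_sub, He in I. specialize (I eq_refl). lra.
Qed.

Lemma nat_above (x : R) : exists N : nat, x <= INR N.
Proof.
  destruct (Rle_dec x 0) as [H | H]; [exists O; simpl; lra|].
  exists (Z.to_nat (up x)). rewrite INR_IZR_INZ. destruct (archimed x) as [A _].
  rewrite Z2Nat.id; [lra|]. apply le_IZR. lra.
Qed.

(* The potential [d / k^2] raises the heat-kernel exponent only from [1/2] to [1/2 + 2d], and
   it dominates the true one near the endpoint, where [k] is small compared with [m]. *)
Lemma bridge_lower_free d : 0 < d ->
  exists eta0, 0 < eta0 < 1 /\ forall eta, 0 < eta <= eta0 ->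
  exists (K0 : nat) (C : R), (2 <= K0)%nat /\ 0 < C /\ forall p k, (K0 <= k)%nat ->
  (forall j, (j < k)%nat -> 0 <= p j /\ p j * INR j ^ 2 <= d) ->
  forall s, Z.even (s + Z.of_nat k) = true ->
  C * exp (- (1 / 2 + 2 * d) * ln (INR k)) * (exp (- ((1 / 2 + d) / INR k) * IZR s ^ 2) - eta)
  <= bridge p k s.
Proof.
  intros Hd. set (gam := 1 / 2 + d).
  destruct (truncated_gauss_average gam d d) as [eta0 [He0 H0]]; try (unfold gam; lra).
  exists eta0. split; auto. intros eta Heta.
  destruct (H0 eta Heta) as [X0 [HX0 HX]].
  assert (Hgam : 0 < gam) by (unfold gam; lra).
  assert (Hln : ln eta < 0) by (rewrite <- ln_1; apply ln_increasing; lra).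
  (* The last summand serves the base case: sites where the Gaussian at [K0] is at least [eta] then
     satisfy [Z.abs s <= K0], so they can reach 0 in [K0] steps. *)
  destruct (nat_above (X0 + 2 + - ln eta / gam)) as [K0 HK0].
  assert (0 < - ln eta / gam) by (apply Rdiv_lt_0_compat; lra).
  assert (HK2 : (2 <= K0)%nat) by (apply INR_le; simpl; lra).
  set (b := 1 / 2 + 2 * d).
  exists K0, ((exp (- d) / 2) ^ K0). split; [auto|]. split.
  { apply pow_lt. pose proof (exp_pos (- d)). lra. }
  set (C := (exp (- d) / 2) ^ K0).
  assert (HC : 0 < C) by (apply pow_lt; pose proof (exp_pos (- d)); lra).
  (* The logarithm is shifted by one because the step loss [b / x] is bounded by
     [b * (ln x - ln (x - 1))], which telescopes; the shift is dropped by monotonicity. *)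
  cut (forall p k, (K0 <= k)%nat ->
    (forall j, (j < k)%nat -> 0 <= p j /\ p j * INR j ^ 2 <= d) ->
    forall s, Z.even (s + Z.of_nat k) = true ->
    C * exp (- b * ln (INR k - 1)) * (exp (- (gam / INR k) * IZR s ^ 2) - eta) <= bridge p k s).
  { intros HH p k Hk Hp s Hs. specialize (HH p k Hk Hp s Hs).
    destruct (Rle_dec eta (exp (- (gam / INR k) * IZR s ^ 2))) as [He | He].
    - eapply Rle_trans; [|exact HH]. apply Rmult_le_compat_r; [lra|].
      apply Rmult_le_compat_l; [lra|]. apply exp_le.
      assert (2 <= INR k) by (apply (le_INR 2); lia).
      assert (ln (INR k - 1) <= ln (INR k)) by (apply ln_le_compat; lra).
      unfold b in *. nra.
    - apply Rle_trans with 0; [|apply bridge_nonneg].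
      assert (0 < C * exp (- b * ln (INR k))) by (apply Rmult_lt_0_compat; [auto | apply exp_pos]).
      nra. }
  intros p k Hk. induction Hk as [|k Hk IH]; intros Hp s Hs.
  - assert (2 <= INR K0) by (apply (le_INR 2); lia).
    destruct (Rle_dec eta (exp (- (gam / INR K0) * IZR s ^ 2))) as [He | He].
    + apply Rle_trans with C.
      * rewrite Rmult_assoc. apply Rle_trans with (C * (1 * 1)); [|lra].
        apply Rmult_le_compat_l; [lra|]. apply Rmult_le_compat.
        -- left; apply exp_pos.
        -- lra.
        -- apply exp_nonpos.
           assert (0 <= ln (INR K0 - 1)) by (rewrite <- ln_1; apply ln_le_compat; lra).
           unfold b. nra.
        -- assert (exp (- (gam / INR K0) * IZR s ^ 2) <= 1); [|lra].
           apply exp_nonpos. pose proof (pow2_ge_0 (IZR s)).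
           assert (0 < gam / INR K0) by (apply Rdiv_lt_0_compat; lra). nra.
      * apply bridge_reach; auto; [lra|].
        assert (L : ln eta <= - (gam / INR K0) * IZR s ^ 2).
        { rewrite <- (ln_exp (- (gam / INR K0) * IZR s ^ 2)). apply ln_le_compat; lra. }
        assert (Q : IZR s ^ 2 <= INR K0 ^ 2).
        { apply Rle_trans with (- ln eta / gam * INR K0).
          - replace (IZR s ^ 2) with (gam / INR K0 * IZR s ^ 2 * (INR K0 / gam)) by (field; lra).
            replace (- ln eta / gam * INR K0) with (- ln eta * (INR K0 / gam)) by (field; lra).
            apply Rmult_le_compat_r; [left; apply Rdiv_lt_0_compat; lra | lra].
          - simpl. rewrite Rmult_1_r. apply Rmult_le_compat_r; lra. }
        rewrite INR_IZR_INZ, !pow_IZR in Q. apply le_IZR in Q. change (Z.of_nat 2) with 2%Z in Q. nia.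
    + apply Rle_trans with 0; [|apply bridge_nonneg].
      assert (0 < C * exp (- b * ln (INR K0 - 1))) by (apply Rmult_lt_0_compat; [auto | apply exp_pos]).
      nra.
  - assert (HkR : INR K0 <= INR k) by (apply le_INR; lia).
    assert (Hk2 : 2 <= INR k) by (apply Rle_trans with (INR K0); [apply (le_INR 2); lia | lra]).
    set (x := INR k) in *.
    assert (Ex : INR (S k) = x + 1) by (rewrite S_INR; reflexivity). rewrite Ex.
    assert (Hi : 0 < / x) by (apply Rinv_0_lt_compat; lra).
    assert (Hst : C * exp (- b * ln (x - 1)) * exp (- (gam + d) / x)
             * (exp (- (gam / (x + 1)) * IZR s ^ 2) - eta) <= bridge p (S k) s).
    { apply bridge_lower_step with (P := d / x ^ 2) (g := gam / x); auto.
      - left; apply Rmult_lt_0_compat; [auto | apply exp_pos].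
      - destruct (Hp k ltac:(lia)) as [_ Hpk]. fold x in Hpk.
        apply Rmult_le_reg_r with (x ^ 2); [nra|].
        replace (d / x ^ 2 * x ^ 2) with d by (field; lra). exact Hpk.
      - intros He. apply HX; auto; [lra| |].
        + split.
          * apply Rmult_le_compat_l; [lra|]. apply Rinv_le_contravar; lra.
          * apply Rle_trans with (gam / x).
            -- apply Rmult_le_compat_l; [lra|]. apply Rinv_le_contravar; lra.
            -- unfold Rdiv. nra.
        + set (G := gam / x + d / x ^ 2).
          assert (HG : gam / x <= G).
          { unfold G. assert (0 < d / x ^ 2) by (apply Rdiv_lt_0_compat; nra). lra. }
          assert (0 < gam / x) by (apply Rdiv_lt_0_compat; lra).
          assert (2 * (gam / x) ^ 2 <= 2 * G ^ 2)
            by (apply Rmult_le_compat_l; [lra | apply pow_incr; lra]).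
          assert (gam / x + d / x ^ 2 - 2 * (gam / x) ^ 2 <= gam / (x + 1)); [|unfold G at 1; lra].
          assert (E : gam / x + d / x ^ 2 - 2 * (gam / x) ^ 2 - gam / (x + 1)
            = ((gam + d - 2 * gam ^ 2) * x + (d - 2 * gam ^ 2)) / (x ^ 2 * (x + 1)))
            by (field; lra).
          assert (((gam + d - 2 * gam ^ 2) * x + (d - 2 * gam ^ 2)) / (x ^ 2 * (x + 1)) <= 0); [|lra].
          assert (0 < / (x ^ 2 * (x + 1))) by (apply Rinv_0_lt_compat; nra).
          (* With [gam = 1 / 2 + d] this coefficient equals [- 2 * d ^ 2]: raising [gam] above 1/2
             pays for the potential [d / x ^ 2]. *)
          assert ((gam + d - 2 * gam ^ 2) * x <= 0) by (unfold gam; nra).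
          assert (d - 2 * gam ^ 2 <= 0) by (unfold gam; nra).
          unfold Rdiv. nra.
      - left; apply exp_pos. }
    destruct (Rle_dec eta (exp (- (gam / (x + 1)) * IZR s ^ 2))) as [He | He].
    + eapply Rle_trans; [|exact Hst]. apply Rmult_le_compat_r; [lra|].
      rewrite (Rmult_assoc C). apply Rmult_le_compat_l; [lra|]. rewrite <- exp_plus.
      apply exp_le. pose proof (ln_succ_ge (x - 1) ltac:(lra)) as L.
      replace (x - 1 + 1) with x in L by ring. replace (x + 1 - 1) with x by ring.
      replace (- (gam + d) / x) with (- b * / x) by (unfold b, gam; field; lra).
      assert (b * / x <= b * (ln x - ln (x - 1))) by (apply Rmult_le_compat_l; unfold b; lra). lra.
    + apply Rle_trans with 0; [|apply bridge_nonneg].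
      assert (0 < C * exp (- b * ln (x + 1 - 1))) by (apply Rmult_lt_0_compat; [auto | apply exp_pos]).
      nra.
Qed.

(** The Gaussians [exp (- c s^2 / i)] satisfy the Riccati inequality thanks to the relation between
    [lam] and [c], and the prefactor loses [(c + d) / x] per step. Both [eta] and [i0] are fixed
    before [m], [M] and [C], so that a starting bound depending on [m] can be plugged in. *)
Lemma bridge_lower_potential lam c d : 0 < c -> lam = c + 2 * c ^ 2 -> 0 < d ->
  exists eta (i0 : nat), 0 < eta < 1 /\ (1 <= i0)%nat /\ forall m M C, (M <= m)%nat -> 0 <= C ->
  (forall s, Z.even (s + Z.of_nat (m - M)) = true ->
     C * (exp (- (c / INR M) * IZR s ^ 2) - eta) <= bridge (invsq lam m) (m - M) s) ->
  forall i, (i0 <= i)%nat -> (i <= M)%nat ->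
  forall s, Z.even (s + Z.of_nat (m - i)) = true ->
  C * exp (- (c + d) * (ln (INR M) - ln (INR i))) * (exp (- (c / INR i) * IZR s ^ 2) - eta)
  <= bridge (invsq lam m) (m - i) s.
Proof.
  intros Hc Hlam Hd.
  assert (Hl0 : 0 < lam) by nra.
  destruct (truncated_gauss_average c lam d Hc Hl0 Hd) as [eta [He0 H0]].
  destruct (H0 eta ltac:(lra)) as [X0 [HX0 HX]]. clear H0.
  destruct (nat_above X0) as [i0 Hi0].
  exists eta, i0. split; auto. split. { apply INR_le; simpl; lra. }
  assert (Hi01 : (1 <= i0)%nat) by (apply INR_le; simpl; lra).
  intros m M C HM HC HV.
  cut (forall e i, (i + e = M)%nat -> (i0 <= i)%nat ->
    forall s, Z.even (s + Z.of_nat (m - i)) = true ->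
    C * exp (- (c + d) * (ln (INR M) - ln (INR i))) * (exp (- (c / INR i) * IZR s ^ 2) - eta)
    <= bridge (invsq lam m) (m - i) s).
  { intros HH i Hi HiM. apply HH with (e := (M - i)%nat); lia. }
  induction e as [|e IH]; intros i Hie Hi s Hs.
  - rewrite Nat.add_0_r in Hie. subst i. rewrite Rminus_diag, Rmult_0_r, exp_0, Rmult_1_r.
    now apply HV.
  - specialize (IH (S i) ltac:(lia) ltac:(lia)).
    replace (m - i)%nat with (S (m - S i)) in * by lia.
    assert (HiR : INR i0 <= INR i) by (apply le_INR; lia).
    rewrite S_INR in IH. set (x := INR i + 1) in *.
    assert (Ei : INR i = x - 1) by (unfold x; ring).
    assert (Hx : 2 <= x) by (unfold x; lra).
    assert (Hst : C * exp (- (c + d) * (ln (INR M) - ln x)) * exp (- (c + d) / x)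
             * (exp (- (c / INR i) * IZR s ^ 2) - eta) <= bridge (invsq lam m) (S (m - S i)) s).
    { apply bridge_lower_step with (P := lam / x ^ 2) (g := c / x); auto.
      - apply Rmult_le_pos; [auto | left; apply exp_pos].
      - unfold invsq. replace (m - (m - S i))%nat with (S i) by lia. rewrite S_INR. fold x. lra.
      - intros He. apply HX; auto; [unfold x; lra| |].
        + rewrite Ei. split; apply Rmult_le_reg_r with (x * (x - 1)); try nra.
          * replace (c / (2 * x) * (x * (x - 1))) with (c * (x - 1) / 2) by (field; lra).
            replace (c / (x - 1) * (x * (x - 1))) with (c * x) by (field; lra). nra.
          * replace (2 * c / x * (x * (x - 1))) with (2 * c * (x - 1)) by (field; lra).
            replace (c / (x - 1) * (x * (x - 1))) with (c * x) by (field; lra). nra.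
        + set (G := c / x + lam / x ^ 2).
          assert (HG : c / x <= G).
          { unfold G. assert (0 < lam / x ^ 2) by (apply Rdiv_lt_0_compat; nra). lra. }
          assert (0 < c / x) by (apply Rdiv_lt_0_compat; lra).
          assert (2 * (c / x) ^ 2 <= 2 * G ^ 2)
            by (apply Rmult_le_compat_l; [lra | apply pow_incr; lra]).
          assert (c / x + lam / x ^ 2 - 2 * (c / x) ^ 2 <= c / INR i); [|unfold G at 1; lra].
          rewrite Hlam, Ei.
          (* The relation [lam = c + 2 * c ^ 2] cancels every term of order [1 / x ^ 2]; the
             remainder has third order and the favourable sign. *)
          assert (E : c / x + (c + 2 * c ^ 2) / x ^ 2 - 2 * (c / x) ^ 2 - c / (x - 1)
            = - (c / (x ^ 2 * (x - 1)))) by (field; lra).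
          assert (0 < c / (x ^ 2 * (x - 1))) by (apply Rdiv_lt_0_compat; nra). lra.
      - left; apply exp_pos. }
    destruct (Rle_dec eta (exp (- (c / INR i) * IZR s ^ 2))) as [He | He].
    + eapply Rle_trans; [|exact Hst]. apply Rmult_le_compat_r; [lra|].
      rewrite (Rmult_assoc C). apply Rmult_le_compat_l; [lra|]. rewrite <- exp_plus.
      apply exp_le. pose proof (ln_succ_ge (INR i) ltac:(lra)) as L. fold x in L.
      replace (- (c + d) / x) with (- (c + d) * / x) by (field; lra).
      assert ((c + d) * / x <= (c + d) * (ln x - ln (INR i))) by (apply Rmult_le_compat_l; lra). lra.
    + apply Rle_trans with 0; [|apply bridge_nonneg].
      assert (0 <= C * exp (- (c + d) * (ln (INR M) - ln (INR i))))
        by (apply Rmult_le_pos; [auto | left; apply exp_pos]).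
      nra.
Qed.

(** * From sign sequences to the weighted bridge *)

Definition lsum {T} (F : T -> R) (l : list T) : R := fold_right Rplus 0 (map F l).
Definition zsum (x : list Z) : Z := fold_right Z.add 0%Z x.

Lemma lsum_ext {T} (F G : T -> R) l : (forall x, In x l -> F x = G x) -> lsum F l = lsum G l.
Proof.
  unfold lsum. intros H. f_equal. now apply map_ext_in.
Qed.

Lemma lsum_scal {T} (F : T -> R) c l : lsum (fun x => F x * c) l = lsum F l * c.
Proof.
  induction l as [|x l IH]; unfold lsum in *; simpl; [ring | rewrite IH; ring].
Qed.

Lemma lsum_filter {T} (F : T -> R) c l :
  lsum F (filter c l) = lsum (fun x => if c x then F x else 0) l.
Proof.
  induction l as [|x l IH]; auto. unfold lsum in *. simpl.
  destruct (c x); simpl; rewrite IH; ring.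
Qed.

Lemma lsum_one {T} (l : list T) : INR (length l) = lsum (fun _ => 1) l.
Proof.
  induction l as [|x l IH]; auto. unfold lsum in *. simpl length. rewrite S_INR, IH. simpl. ring.
Qed.

Lemma lsum_sign_seqs_S F k :
  lsum F (sign_seqs (S k)) = lsum (fun x => F (1 :: x)%Z + F ((-1) :: x)%Z) (sign_seqs k).
Proof.
  simpl. induction (sign_seqs k) as [|x l IH]; auto. unfold lsum in *. simpl. rewrite IH. ring.
Qed.

Lemma lsum_plus {T} (F G : T -> R) l : lsum (fun x => F x + G x) l = lsum F l + lsum G l.
Proof.
  induction l as [|x l IH]; unfold lsum in *; simpl; [ring | rewrite IH; ring].
Qed.

Lemma lsum_sign_seqs_app F a b :
  lsum F (sign_seqs (a + b))
  = lsum (fun y => lsum (fun z => F (y ++ z)) (sign_seqs b)) (sign_seqs a).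
Proof.
  revert F; induction a as [|a IH]; intros F.
  - unfold lsum at 2. simpl. rewrite Rplus_0_r. reflexivity.
  - rewrite Nat.add_succ_l, !lsum_sign_seqs_S, IH. apply lsum_ext. intros y _.
    rewrite <- lsum_plus. reflexivity.
Qed.

Lemma sign_seqs_length k x : In x (sign_seqs k) -> length x = k.
Proof.
  revert x; induction k as [|k IH]; intros x H; simpl in H.
  - destruct H as [<- | []]; reflexivity.
  - apply in_flat_map in H. destruct H as [y [Hy [<- | [<- | []]]]]; simpl; f_equal; auto.
Qed.

Lemma zsum_app x y : zsum (x ++ y) = (zsum x + zsum y)%Z.
Proof. induction x as [|a x IH]; simpl; auto. rewrite IH. ring. Qed.

Lemma Spart_app y z : Spart (y ++ z) (length y) = zsum y.
Proof.
  unfold Spart. rewrite firstn_app, Nat.sub_diag, firstn_all, app_nil_r. reflexivity.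
Qed.

Lemma Spart_all y : Spart y (length y) = zsum y.
Proof. unfold Spart. now rewrite firstn_all. Qed.

(** The potential energy is accumulated while the steps are read, from time [i] and position [s], so
    that its recursion matches that of [bridge]. *)
Fixpoint energy (q : nat -> R) (i : nat) (s : Z) (z : list Z) : R :=
  match z with
  | [] => 0
  | x :: z' => q (S i) * IZR (s + x) ^ 2 + energy q (S i) (s + x) z'
  end.

(** The prefix [y] stays general so that the induction on [z] can move the head of [z] to the end of
    [y]. *)
Lemma energy_Spart q z y :
  lsum (fun j => q j * IZR (Spart (y ++ z) j) ^ 2) (seq (S (length y)) (length z))
  = energy q (length y) (zsum y) z.
Proof.
  revert y; induction z as [|x z IH]; intros y; auto.
  simpl length. cbn [seq energy]. specialize (IH (y ++ [x])).
  rewrite length_app, <- app_assoc, zsum_app in IH.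
  replace (zsum [x]) with x in IH by (simpl; ring).
  rewrite Nat.add_1_r in IH. simpl app in IH. rewrite <- IH.
  unfold lsum. cbn [map fold_right]. f_equal. f_equal. f_equal. f_equal.
  pose proof (Spart_app (y ++ [x]) z) as E. rewrite <- app_assoc, length_app, zsum_app in E.
  simpl app in E. simpl length in E. rewrite Nat.add_1_r in E. rewrite E. simpl. ring.
Qed.

(** The factor [2 ^ k] undoes the averaging in [bridge]. A step that leaves [j] further steps ends
    at time [i + k - j], whence the reindexed potential. *)
Lemma lsum_bridge q k i s :
  lsum (fun z => if Z.eqb (s + zsum z) 0 then exp (- energy q i s z) else 0) (sign_seqs k)
  = 2 ^ k * bridge (fun j => q (i + k - j)%nat) k s.
Proof.
  revert i s; induction k as [|k IH]; intros i s.
  - unfold lsum. simpl. rewrite Z.add_0_r, Ropp_0, exp_0. destruct (Z.eqb s 0); ring.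
  - rewrite lsum_sign_seqs_S, lsum_plus. cbn [bridge].
    assert (S1 : forall e : Z,
      lsum (fun z => if Z.eqb (s + zsum (e :: z)) 0 then exp (- energy q i s (e :: z)) else 0)
        (sign_seqs k)
      = 2 ^ k * (exp (- q (i + S k - k)%nat * IZR (s + e) ^ 2)
                 * bridge (fun j => q (i + S k - j)%nat) k (s + e))).
    { intros e. specialize (IH (S i) (s + e)%Z).
      replace (fun j => q (S i + k - j)%nat) with (fun j => q (i + S k - j)%nat) in IH
        by (rewrite Nat.add_succ_l, Nat.add_succ_r; reflexivity).
      replace (2 ^ k * (exp (- q (i + S k - k)%nat * IZR (s + e) ^ 2)
                 * bridge (fun j => q (i + S k - j)%nat) k (s + e)))
        with (2 ^ k * bridge (fun j => q (i + S k - j)%nat) k (s + e)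
              * exp (- q (i + S k - k)%nat * IZR (s + e) ^ 2)) by ring.
      rewrite <- IH, <- lsum_scal. apply lsum_ext. intros z _.
      replace (zsum (e :: z)) with (e + zsum z)%Z by reflexivity. rewrite Z.add_assoc.
      destruct (Z.eqb (s + e + zsum z) 0); [|ring].
      rewrite <- exp_plus. f_equal. cbn [energy].
      replace (i + S k - k)%nat with (S i) by lia. ring. }
    rewrite (S1 1%Z), (S1 (-1)%Z). change (s + -1)%Z with (s - 1)%Z.
    rewrite <- (tech_pow_Rmult 2 k). field.
Qed.

(** Markov property at time [2 * Acut n - 2]: the prefix returns to 0 and contributes nothing to
    [Lmain], so it is a bridge with zero potential, and the suffix starts afresh from 0. *)
Lemma cond_sum_factor n lam : (1 <= Acut n)%nat -> (Acut n <= n)%nat ->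
  lsum (fun x => exp (- lam * Lmain n x)) (filter (COND n) (sign_seqs (2 * n - 2)))
  = 2 ^ (2 * n - 2) * bridge (fun _ => 0) (2 * Acut n - 2) 0
    * bridge (invsq lam (2 * n - 2)) (2 * n - 2 - (2 * Acut n - 2)) 0.
Proof.
  intros HA HAn. set (a := (2 * Acut n - 2)%nat). set (m := (2 * n - 2)%nat).
  set (b := (m - a)%nat). assert (Em : m = (a + b)%nat) by (unfold b, m, a; lia).
  rewrite lsum_filter. rewrite Em at 1. rewrite lsum_sign_seqs_app.
  pose (q := fun j => lam / INR j ^ 2).
  assert (EB : 2 ^ a * bridge (fun _ => 0) a 0
     = lsum (fun y => if Z.eqb (0 + zsum y) 0 then exp (- energy (fun _ => 0) 0 0 y) else 0)
         (sign_seqs a)) by (rewrite lsum_bridge; reflexivity).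
  rewrite Em at 1. rewrite pow_add.
  replace (2 ^ a * 2 ^ b * bridge (fun _ => 0) a 0 * bridge (invsq lam m) b 0)
    with (2 ^ a * bridge (fun _ => 0) a 0 * (2 ^ b * bridge (invsq lam m) b 0)) by ring.
  rewrite EB, <- lsum_scal. apply lsum_ext. intros y Hy. apply sign_seqs_length in Hy.
  assert (E0 : forall i s z, energy (fun _ => 0) i s z = 0).
  { intros i s z; revert i s; induction z as [|x z IH]; intros; cbn [energy]; auto.
    rewrite IH; ring. }
  rewrite E0, Ropp_0, exp_0, Z.add_0_l.
  replace (2 ^ b * bridge (invsq lam m) b 0) with
    (lsum (fun z => if Z.eqb (0 + zsum z) 0 then exp (- energy q a 0 z) else 0) (sign_seqs b)).
  2: { rewrite lsum_bridge. unfold invsq, q. rewrite Em. reflexivity. }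
  rewrite Rmult_comm, <- lsum_scal. apply lsum_ext. intros z Hz. apply sign_seqs_length in Hz.
  unfold COND. fold a m. rewrite <- Hy at 1. rewrite Spart_app.
  replace (Spart (y ++ z) m) with (zsum y + zsum z)%Z.
  2: { replace m with (length (y ++ z)) by (rewrite length_app; lia).
       rewrite Spart_all, zsum_app. reflexivity. }
  destruct (Z.eqb_spec (zsum y) 0) as [Ey | Ey]; cbn [andb]; [|ring].
  rewrite Ey. destruct (Z.eqb (0 + zsum z) 0); [|ring]. rewrite Rmult_1_r. f_equal.
  pose proof (energy_Spart q z y) as E. rewrite Hy, Hz, Ey in E. rewrite <- E.
  rewrite <- Ropp_mult_distr_l. f_equal.
  (* The energy sums over the [b] times from [a + 1] to [m], exactly the range in [Lmain];
     [1 <= Acut n] keeps the truncated subtraction exact. *)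
  unfold Lmain. replace (2 * Acut n - 1)%nat with (S a) by (unfold a; lia).
  replace (2 * n - 1 - S a)%nat with b by (unfold b, m; lia).
  change (fold_right Rplus 0 (map ?f ?l)) with (lsum f l).
  rewrite Rmult_comm, <- lsum_scal. apply lsum_ext. intros j _. unfold q, Rdiv. ring.
Qed.

Lemma even_of_nat k : Nat.even k = true -> Z.even (0 + Z.of_nat k) = true.
Proof.
  intros Hk. apply Nat.even_spec in Hk. destruct Hk as [h ->].
  rewrite Nat2Z.inj_mul. apply Z.even_spec. now exists (Z.of_nat h).
Qed.

Lemma bridge_zero_pos k : Nat.even k = true -> 0 < bridge (fun _ => 0) k 0.
Proof.
  intros Hk. apply Rlt_le_trans with ((exp (- 0) / 2) ^ k).
  - apply pow_lt. pose proof (exp_pos (- 0)). lra.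
  - apply bridge_reach; [lra | intros; lra | lia | now apply even_of_nat].
Qed.

Lemma bridge_ext p p' k s : (forall j, (j < k)%nat -> p j = p' j) -> bridge p k s = bridge p' k s.
Proof.
  revert s; induction k as [|k IH]; intros s H; auto.
  cbn [bridge]. rewrite H by lia. rewrite !IH by (intros; apply H; lia). reflexivity.
Qed.

(** The number of admissible sequences is the same weighted sum with [lam = 0], so the power of 2
    and the prefix factor cancel. Both time spans are even, which makes the denominators
    positive. *)
Lemma cond_exp_bridge n lam : (1 <= Acut n)%nat -> (Acut n <= n)%nat ->
  cond_exp n lam = bridge (invsq lam (2 * n - 2)) (2 * n - 2 - (2 * Acut n - 2)) 0
                   / bridge (fun _ => 0) (2 * n - 2 - (2 * Acut n - 2)) 0.
Proof.
  intros HA HAn. unfold cond_exp.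
  change (fold_right Rplus 0 (map ?f ?l)) with (lsum f l). rewrite lsum_one.
  rewrite (lsum_ext (fun _ => 1) (fun x => exp (- 0 * Lmain n x))).
  2: { intros x _. rewrite Ropp_0, Rmult_0_l, exp_0. reflexivity. }
  rewrite !cond_sum_factor by auto.
  rewrite (bridge_ext (invsq 0 (2 * n - 2)) (fun _ => 0))
    by (intros; unfold invsq, Rdiv; ring).
  field. repeat split; apply Rgt_not_eq.
  - apply bridge_zero_pos. apply Nat.even_spec. exists (n - 1 - (Acut n - 1))%nat. lia.
  - apply bridge_zero_pos. apply Nat.even_spec. exists (Acut n - 1)%nat. lia.
  - apply pow_lt; lra.
Qed.

(** * Asymptotics *)

Lemma INR_ge_1 k : (1 <= k)%nat -> 1 <= INR k.
Proof. exact (le_INR 1 k). Qed.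

Lemma ln_nonneg x : 1 <= x -> 0 <= ln x.
Proof. intros H. rewrite <- ln_1. apply ln_le_compat; lra. Qed.

(** Two bounds are glued at time [M = m - m / Q]: the free one on the last [m / Q] steps, with
    exponent [1 / 2 + 2 * d], and the one with potential from [M] back to [a], with exponent
    [c + d]. *)
Lemma bridge_lower lam c d : 0 < c -> lam = c + 2 * c ^ 2 -> 0 < d ->
  exists C (N i0 : nat), 0 < C /\ forall m a : nat, (N <= m)%nat -> (i0 <= a)%nat ->
  (2 * a <= m)%nat -> Nat.even (m - a) = true ->
  C * exp (- (c + 1 / 2 + 3 * d) * ln (INR m)) <= bridge (invsq lam m) (m - a) 0.
Proof.
  intros Hc Hlam Hd.
  destruct (bridge_lower_potential lam c d Hc Hlam Hd) as [eta1 [i0 [He1 [Hi0 H1]]]].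
  destruct (bridge_lower_free d Hd) as [eta0 [He0 H0]].
  assert (Hl0 : 0 < lam) by nra.
  (* [Q] is so large that [lam <= d * (INR Q - 1) ^ 2]. On the last [m / Q] steps one has
     [m - j >= (Q - 1) * j], so the potential there is at most [d / j ^ 2]. *)
  destruct (nat_above (lam / d)) as [Q' HQ']. set (Q := (Q' + 2)%nat).
  assert (HQ : lam <= d * (INR Q - 1) ^ 2).
  { replace lam with (d * (lam / d)) by (field; lra). apply Rmult_le_compat_l; [lra|].
    unfold Q. rewrite plus_INR. simpl (INR 2). pose proof (pos_INR Q'). nra. }
  assert (HQR : 2 <= INR Q) by (apply (le_INR 2); unfold Q; lia).
  set (gam := 1 / 2 + d). set (R1 := - ln eta1 / c).
  assert (Hln1 : ln eta1 < 0) by (rewrite <- ln_1; apply ln_increasing; lra).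
  assert (HR1 : 0 < R1) by (apply Rdiv_lt_0_compat; lra).
  (* Where the Gaussian at [M] is at least [eta1], [s ^ 2] is at most [R1 * INR M]; there the
     Gaussian of the free bound is at least [2 * w], hence at least [2 * eta2], and exceeds its
     truncation level by [eta2]. *)
  set (w := exp (- (gam * (2 * INR Q * R1))) / 2).
  assert (Hw : 0 < w) by (unfold w; pose proof (exp_pos (- (gam * (2 * INR Q * R1)))); lra).
  set (eta2 := Rmin eta0 w).
  assert (He2 : 0 < eta2 <= eta0) by (split; [apply Rmin_glb_lt; lra | apply Rmin_l]).
  assert (Hew : eta2 <= w) by apply Rmin_r.
  destruct (H0 eta2 He2) as [K0 [C0 [HK0 [HC0 HF]]]].
  exists (C0 * eta2 * (1 - eta1)), (Q * K0 + 2 * Q)%nat, i0. split.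
  { repeat apply Rmult_lt_0_compat; lra. }
  intros m a Hm Hia Ham Hev.
  set (k1 := (m / Q)%nat). set (M := (m - k1)%nat).
  assert (HQ0 : (2 <= Q)%nat) by (unfold Q; lia).
  assert (Hk1 : (Q * k1 <= m)%nat) by (apply Nat.Div0.mul_div_le).
  assert (Hk1' : (m < Q * k1 + Q)%nat).
  { pose proof (Nat.mul_succ_div_gt m Q ltac:(lia)). unfold k1. nia. }
  assert (HkK : (K0 <= k1)%nat) by nia.
  assert (Hk2 : (m <= 2 * Q * k1)%nat) by nia.
  assert (HM : (M <= m)%nat) by (unfold M; lia).
  assert (EmM : (m - M)%nat = k1) by (unfold M; nia).
  assert (HMa : (a <= M)%nat) by (unfold M; nia).
  assert (Hk1R : 1 <= INR k1) by (apply INR_ge_1; lia).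
  assert (HMR : 1 <= INR M) by (apply INR_ge_1; nia).
  assert (HmR : INR M <= INR m) by (now apply le_INR).
  assert (HaR : 1 <= INR a) by (apply INR_ge_1; lia).
  assert (HkmR : INR k1 <= INR m) by (apply le_INR; nia).
  assert (Hk2R : INR m <= 2 * INR Q * INR k1).
  { apply le_INR in Hk2. rewrite !mult_INR in Hk2. exact Hk2. }
  set (b := 1 / 2 + 2 * d).
  set (C := C0 * exp (- b * ln (INR m)) * eta2).
  assert (HCm : 0 < C0 * exp (- b * ln (INR m))) by (apply Rmult_lt_0_compat; [auto | apply exp_pos]).
  assert (HC : 0 < C) by (apply Rmult_lt_0_compat; lra).
  assert (Hfree : forall s, Z.even (s + Z.of_nat (m - M)) = true ->
     C * (exp (- (c / INR M) * IZR s ^ 2) - eta1) <= bridge (invsq lam m) (m - M) s).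
  { rewrite EmM. intros s Hs.
    destruct (Rle_dec eta1 (exp (- (c / INR M) * IZR s ^ 2))) as [He | He].
    2: { apply Rle_trans with 0; [nra | apply bridge_nonneg]. }
    pose proof (pow2_ge_0 (IZR s)) as Hs0.
    assert (Hs2 : IZR s ^ 2 <= R1 * INR M).
    { assert (L : ln eta1 <= - (c / INR M) * IZR s ^ 2).
      { rewrite <- (ln_exp (- (c / INR M) * IZR s ^ 2)). apply ln_le_compat; lra. }
      replace (IZR s ^ 2) with (c / INR M * IZR s ^ 2 * (INR M / c)) by (field; lra).
      replace (R1 * INR M) with (- ln eta1 * (INR M / c)) by (unfold R1; field; lra).
      apply Rmult_le_compat_r; [left; apply Rdiv_lt_0_compat; lra | lra]. }
    assert (Hs3 : 2 * eta2 <= exp (- (gam / INR k1) * IZR s ^ 2)).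
    { apply Rle_trans with (exp (- (gam * (2 * INR Q * R1)))); [unfold w in Hew; lra|].
      apply exp_le.
      replace (- (gam * (2 * INR Q * R1)))
        with (- (gam / INR k1) * (R1 * (2 * INR Q * INR k1))) by (field; lra).
      assert (0 < gam / INR k1) by (apply Rdiv_lt_0_compat; unfold gam; lra).
      assert (IZR s ^ 2 <= R1 * (2 * INR Q * INR k1)).
      { eapply Rle_trans; [exact Hs2|]. apply Rmult_le_compat_l; lra. }
      nra. }
    eapply Rle_trans; [|apply HF with (k := k1); auto].
    - fold gam b. apply Rle_trans with C.
      + rewrite <- (Rmult_1_r C) at 2. apply Rmult_le_compat_l; [lra|].
        assert (exp (- (c / INR M) * IZR s ^ 2) <= 1); [|lra].
        apply exp_nonpos. assert (0 < c / INR M) by (apply Rdiv_lt_0_compat; lra). nra.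
      + unfold C. apply Rmult_le_compat; try lra.
        apply Rmult_le_compat_l; [lra|]. apply exp_le.
        assert (ln (INR k1) <= ln (INR m)) by (apply ln_le_compat; lra).
        unfold b; nra.
    - intros j Hj. unfold invsq.
      assert (Hmj : (1 <= m - j)%nat) by nia.
      apply INR_ge_1 in Hmj.
      assert (Hqj : (INR Q - 1) * INR j <= INR (m - j)).
      { assert (Q * j <= m)%nat by nia. apply le_INR in H. rewrite mult_INR in H.
        rewrite minus_INR by nia. lra. }
      split; [left; apply Rdiv_lt_0_compat; [lra | apply pow_lt; lra]|].
      apply Rmult_le_reg_r with (INR (m - j) ^ 2); [apply pow_lt; lra|].
      replace (lam / INR (m - j) ^ 2 * INR j ^ 2 * INR (m - j) ^ 2) with (lam * INR j ^ 2)
        by (field; lra).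
      apply Rle_trans with (d * (INR Q - 1) ^ 2 * INR j ^ 2).
      + apply Rmult_le_compat_r; [apply pow2_ge_0 | exact HQ].
      + replace (d * (INR Q - 1) ^ 2 * INR j ^ 2) with (d * ((INR Q - 1) * INR j) ^ 2) by ring.
        apply Rmult_le_compat_l; [lra|]. apply pow_incr. split; auto.
        apply Rmult_le_pos; [lra | apply pos_INR]. }
  assert (HE0 : Z.even (0 + Z.of_nat (m - a)) = true) by (now apply even_of_nat).
  pose proof (H1 m M C HM (Rlt_le _ _ HC) Hfree a Hia HMa 0%Z HE0) as HH.
  replace (- (c / INR a) * 0 ^ 2) with 0 in HH by (simpl; ring). rewrite exp_0 in HH.
  eapply Rle_trans; [|exact HH].
  replace (C0 * eta2 * (1 - eta1) * exp (- (c + 1 / 2 + 3 * d) * ln (INR m)))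
    with (C * exp (- (c + d) * ln (INR m)) * (1 - eta1)).
  - apply Rmult_le_compat_r; [lra|]. apply Rmult_le_compat_l; [lra|]. apply exp_le.
    pose proof (ln_nonneg _ HaR).
    assert (ln (INR M) <= ln (INR m)) by (apply ln_le_compat; lra). nra.
  - unfold C. replace (- (c + 1 / 2 + 3 * d) * ln (INR m))
      with (- b * ln (INR m) + - (c + d) * ln (INR m)) by (unfold b; ring).
    rewrite exp_plus. ring.
Qed.

Lemma bridge_upper_uniform p k d : 0 < d <= 1 / 2 -> (1 <= k)%nat ->
  (forall j, (j < k)%nat -> 0 <= p j) ->
  forall s, bridge p k s <= exp ((1 / 2 - d) * ln (/ (2 * d))) * exp (- (1 / 2 - d) * ln (INR k)).
Proof.
  (* For [th = 1 / 2 - d] this [K] satisfies [2 * th * (K + 1) <= K] with slack [2 * d]. *)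
  intros Hd Hk Hp s. set (K := / (2 * d)). set (th := 1 / 2 - d).
  assert (HK : 0 < K) by (apply Rinv_0_lt_compat; lra).
  assert (HdK : 2 * d * K = 1) by (apply Rinv_r; lra).
  assert (HkR := INR_ge_1 k Hk).
  eapply Rle_trans; [apply (bridge_upper_free p k th K); auto; unfold th; nra|].
  rewrite <- !exp_plus. apply exp_le.
  assert (ln (INR k) <= ln (INR k + K)) by (apply ln_le_compat; lra).
  assert (0 <= th / (INR k + K) * IZR s ^ 2).
  { apply Rmult_le_pos; [|apply pow2_ge_0]. apply Rmult_le_pos; [unfold th; lra|].
    left; apply Rinv_0_lt_compat; lra. }
  assert (th * ln (INR k) <= th * ln (INR k + K)) by (apply Rmult_le_compat_l; unfold th; lra).
  lra.
Qed.

(** Split at half time: on the second half only nonnegativity of the potential is used, which gives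
    the exponent [1 / 2 - d]; the first half is run with [c - d] in place of [c], and this loss
    makes the Riccati conditions strict enough for large [a]. *)
Lemma bridge_upper lam c d : 0 < c -> lam = c + 2 * c ^ 2 -> 0 < d <= 1 / 2 -> d <= c ->
  exists C (i0 : nat), 0 < C /\ (1 <= i0)%nat /\ forall h a : nat, (i0 <= a)%nat -> (a <= h)%nat ->
  bridge (invsq lam (2 * h)) (2 * h - a) 0
  <= C * exp (- (c + 1 / 2 - 2 * d) * ln (INR h) + c * ln (INR a)).
Proof.
  intros Hc Hlam Hd Hdc. set (mu := 2 * c ^ 2).
  assert (Hmu : 0 < mu) by (unfold mu; nra).
  assert (Hl0 : 0 < lam) by (unfold mu in Hmu; lra).
  destruct (nat_above (1 + mu / d + 3 * lam / d)) as [i0 Hi0].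
  assert (0 < mu / d) by (apply Rdiv_lt_0_compat; lra).
  assert (0 < 3 * lam / d) by (apply Rdiv_lt_0_compat; lra).
  set (C1 := exp ((1 / 2 - d) * ln (/ (2 * d)))).
  exists (C1 * exp (c - d)), i0. split; [apply Rmult_lt_0_compat; apply exp_pos|].
  assert (Hi1 : (1 <= i0)%nat) by (apply INR_le; simpl; lra). split; auto.
  intros h a Hia Hah.
  assert (HaR : INR i0 <= INR a) by (now apply le_INR).
  assert (Ha1 : 1 <= INR a) by lra.
  assert (Hh1 : 1 <= INR h) by (apply INR_ge_1; lia).
  set (y := / INR a). assert (Hy : 0 < y) by (apply Rinv_0_lt_compat; lra).
  assert (Eay : INR a * y = 1) by (apply Rinv_r; lra).
  assert (B1 : mu * y <= d).
  { apply Rmult_le_reg_r with (INR a); [lra|]. rewrite Rmult_assoc, (Rmult_comm y), Eay.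
    apply Rmult_le_reg_l with (/ d); [apply Rinv_0_lt_compat; lra|].
    replace (/ d * (d * INR a)) with (INR a) by (field; lra). unfold Rdiv in *. lra. }
  assert (B2 : 3 * lam * y <= d).
  { apply Rmult_le_reg_r with (INR a); [lra|]. rewrite Rmult_assoc, (Rmult_comm y), Eay.
    apply Rmult_le_reg_l with (/ d); [apply Rinv_0_lt_compat; lra|].
    replace (/ d * (d * INR a)) with (INR a) by (field; lra). unfold Rdiv in *. lra. }
  assert (Hy1 : y <= 1). { apply Rmult_le_reg_r with (INR a); [lra|]. rewrite Rmult_comm, Eay. lra. }
  assert (HU : forall s, bridge (invsq lam (2 * h)) (2 * h - h) s
     <= C1 * exp (- (1 / 2 - d) * ln (INR h))).
  { replace (2 * h - h)%nat with h by lia. apply bridge_upper_uniform; auto; [lia|].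
    intros j Hj. unfold invsq. left. apply Rdiv_lt_0_compat; [lra|]. apply pow_lt.
    apply lt_0_INR. lia. }
  eapply Rle_trans.
  { apply (bridge_upper_potential lam (c - d) mu (C1 * exp (- (1 / 2 - d) * ln (INR h)))
      (2 * h) h a); auto; try lra; try lia.
    - left; apply Rmult_lt_0_compat; apply exp_pos.
    - unfold Rdiv. fold y. unfold mu at 2. apply Rmult_le_compat_l; [lra|].
      apply pow_incr. split; [|lra].
      assert (0 < mu * y) by (apply Rmult_lt_0_compat; lra). lra.
    (* For [y <= 1] one has [(1 + y) ^ 2 <= 1 + 3 * y], and [3 * lam * y <= d] absorbs the
       excess. *)
    - fold y. apply Rle_trans with ((lam - d) * (1 + 3 * y)).
      + replace (c - d + mu) with (lam - d) by (unfold mu; lra).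
        apply Rmult_le_compat_l; [unfold mu in *; lra|]. nra.
      + nra. }
  replace (- ((c - d) * (/ INR a - / INR h)) * 0 ^ 2) with 0 by (simpl; ring).
  rewrite exp_0, Rmult_1_r, !Rmult_assoc. apply Rmult_le_compat_l; [left; apply exp_pos|].
  rewrite <- !exp_plus. apply exp_le. pose proof (ln_nonneg _ Ha1). nra.
Qed.

Lemma bridge_zero_lower d : 0 < d ->
  exists C (K0 : nat), 0 < C /\ forall k, (K0 <= k)%nat -> Nat.even k = true ->
  C * exp (- (1 / 2 + 2 * d) * ln (INR k)) <= bridge (fun _ => 0) k 0.
Proof.
  intros Hd. destruct (bridge_lower_free d Hd) as [eta [He H0]].
  destruct (H0 eta ltac:(lra)) as [K0 [C [HK [HC HF]]]].
  exists (C * (1 - eta)), K0. split; [apply Rmult_lt_0_compat; lra|].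
  intros k Hk Hev.
  assert (HE0 : Z.even (0 + Z.of_nat k) = true) by (now apply even_of_nat).
  pose proof (HF (fun _ => 0) k Hk ltac:(intros; lra) 0%Z HE0) as HH.
  replace (- ((1 / 2 + d) / INR k) * 0 ^ 2) with 0 in HH by (simpl; ring). rewrite exp_0 in HH.
  lra.
Qed.

(** * Size of the cutoff *)

(** Writing the exponential as a 20th power gives the lower bound [(t * x / 20) ^ 20]; twice the
    needed degree lets the assumption on [x] absorb the constant. *)
Lemma pow10_le_exp t x : 0 < t -> 0 <= x -> (20 / t) ^ 2 <= x -> x ^ 10 <= exp (t * x).
Proof.
  intros Ht Hx0 Hx.
  replace (exp (t * x)) with (exp (t * x / 20) ^ 20).
  2: { replace (t * x) with (INR 20 * (t * x / 20)) at 2 by (simpl; field).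
       generalize (t * x / 20). intros u. generalize 20%nat. intros n.
       induction n as [|n IH]; [simpl; rewrite Rmult_0_l, exp_0; reflexivity|].
       rewrite S_INR, Rmult_plus_distr_r, Rmult_1_l, exp_plus, <- IH. simpl. ring. }
  assert (H1 : t * x / 20 <= exp (t * x / 20)) by (pose proof (exp_ineq1_le (t * x / 20)); lra).
  assert (H0 : 0 <= t * x / 20) by (assert (0 <= t * x) by nra; lra).
  apply Rle_trans with ((t * x / 20) ^ 20); [|apply pow_incr; lra].
  replace ((t * x / 20) ^ 20) with (((t * x / 20) ^ 2) ^ 10) by ring.
  apply pow_incr. split; auto.
  replace ((t * x / 20) ^ 2) with (x * ((t / 20) ^ 2 * x)) by field.
  rewrite <- (Rmult_1_r x) at 1. apply Rmult_le_compat_l; auto.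
  replace 1 with ((t / 20) ^ 2 * (20 / t) ^ 2) by (field; lra).
  apply Rmult_le_compat_l; [apply pow2_ge_0 | exact Hx].
Qed.

Lemma Acut_bounds n : 1 <= ln (INR n) ->
  ln (INR n) - 1 <= INR (Acut n) <= ln (INR n) ^ 10.
Proof.
  intros H. unfold Acut. set (L := ln (INR n)) in *.
  assert (HL : L <= L ^ 10).
  { replace (L ^ 10) with (L * L ^ 9) by ring. rewrite <- (Rmult_1_r L) at 1.
    apply Rmult_le_compat_l; [lra|]. now apply pow_R1_Rle. }
  destruct (base_Int_part (L ^ 10)) as [B1 B2].
  rewrite INR_IZR_INZ, Z2Nat.id; [lra|].
  assert (-1 < Int_part (L ^ 10))%Z by (apply lt_IZR; lra). lia.
Qed.

Lemma Acut_small t (N : nat) : 0 < t -> exists L0, forall n, L0 <= ln (INR n) ->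
  (N + 2 <= Acut n)%nat /\ (4 * Acut n <= n)%nat /\
  ln (INR (Acut n)) <= t * ln (INR n).
Proof.
  intros Ht. exists (INR N + 5 + (20 / t) ^ 2 + (20 / (1 / 2)) ^ 2).
  intros n Hn. pose proof (pos_INR N). pose proof (pow2_ge_0 (20 / t)).
  pose proof (pow2_ge_0 (20 / (1 / 2))).
  destruct (Acut_bounds n ltac:(lra)) as [B1 B2].
  set (L := ln (INR n)) in *.
  assert (HN : (N + 2 <= Acut n)%nat) by (apply INR_le; rewrite plus_INR; simpl; lra).
  assert (HA : 1 <= INR (Acut n)) by (apply INR_ge_1; lia).
  (* The case [n = 0] is excluded because [ln 0] takes the default value 0, below the threshold. *)
  assert (Hn0 : 0 < INR n).
  { destruct n; [|apply lt_0_INR; lia]. exfalso. unfold L in Hn. simpl in Hn.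
    unfold ln in Hn. destruct (Rlt_dec 0 0); lra. }
  split; [exact HN|]. split.
  - apply INR_le. rewrite mult_INR. replace (INR 4) with 4 by (simpl; ring).
    assert (E : exp L = exp (1 / 2 * L) * exp (1 / 2 * L)) by (rewrite <- exp_plus; f_equal; field).
    unfold L at 1 in E. rewrite exp_ln in E by auto. rewrite E.
    assert (L ^ 10 <= exp (1 / 2 * L)) by (apply pow10_le_exp; lra).
    assert (4 <= exp (1 / 2 * L)).
    { pose proof (exp_ineq1_le (1 / 2 * L)). lra. }
    nra.
  - rewrite <- (ln_exp (t * L)). apply ln_le_compat; [lra|].
    eapply Rle_trans; [exact B2|]. apply pow10_le_exp; lra.
Qed.

(* E[e^{-lam L^main} | COND] = n^{-(alpha-1)/2 + o(1)} as n -> infinity. *)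
Theorem mainTheorem12 :
  forall alpha : R, 1 < alpha ->
  let lam := alpha * (alpha - 1) / 2 in
  forall eps : R, 0 < eps ->
  exists N : nat, forall n : nat, (N <= n)%nat ->
    Rpower (INR n) (- (alpha - 1) / 2 - eps) <= cond_exp n lam
    <= Rpower (INR n) (- (alpha - 1) / 2 + eps).
Proof.
  intros alpha Halpha lam eps Heps. set (c := (alpha - 1) / 2).
  assert (Hc : 0 < c) by (unfold c; lra).
  assert (Hlam : lam = c + 2 * c ^ 2) by (unfold lam, c; field).
  (* The upper bound spends [6 * d]: [2 * d] from the numerator, [2 * d] from the denominator, [d]
     from [ln (INR a)] and [d] from the constants. The lower bound spends [5 * d]. *)
  set (d := Rmin (eps / 6) (Rmin c (1 / 2))).
  assert (Hd : 0 < d) by (repeat apply Rmin_glb_lt; lra).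
  assert (Hde : d <= eps / 6) by apply Rmin_l.
  assert (Hd2 : d <= Rmin c (1 / 2)) by apply Rmin_r.
  assert (Hdc : d <= c) by (eapply Rle_trans; [exact Hd2 | apply Rmin_l]).
  assert (Hdh : d <= 1 / 2) by (eapply Rle_trans; [exact Hd2 | apply Rmin_r]). clear Hd2.
  destruct (bridge_lower lam c d Hc Hlam Hd) as [C3 [N3 [i3 [HC3 HL]]]].
  destruct (bridge_upper lam c d Hc Hlam ltac:(lra) Hdc) as [C1 [i1 [HC1 [Hi1 HU]]]].
  destruct (bridge_zero_lower d Hd) as [C2 [K2 [HC2 HZ]]].
  set (C4 := exp ((1 / 2 - d) * ln (/ (2 * d)))).
  (* The ratio [d / c] turns the factor [exp (c * ln (INR a))] of the upper bound into at most a
     constant times [exp (d * L)]. *)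
  destruct (Acut_small (d / c) (i1 + i3 + N3 + K2) ltac:(apply Rdiv_lt_0_compat; lra))
    as [L0 HA].
  (* All multiplicative constants and all terms with [ln 2], which come from comparing [h], [k] and
     [2 * h] with [n]; for large [n] they total at most [d * L]. *)
  set (W := Rabs (ln C1) + Rabs (ln C2) + Rabs (ln C3) + Rabs (ln C4) + (2 * c + 2 + 4 * d) * ln 2).
  assert (Hln2 : 0 <= ln 2) by (apply ln_nonneg; lra).
  destruct (nat_above (exp (Rmax L0 (W / d)))) as [N HN].
  exists (N + 2)%nat. intros n Hn.
  assert (HnR : 2 <= INR n) by (apply (le_INR 2); lia).
  set (L := ln (INR n)).
  assert (HLm : Rmax L0 (W / d) <= L).
  { rewrite <- (ln_exp (Rmax L0 (W / d))). apply ln_le_compat; [apply exp_pos|].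
    eapply Rle_trans; [exact HN|]. apply le_INR; lia. }
  assert (HL0 : L0 <= L) by (eapply Rle_trans; [apply Rmax_l | exact HLm]).
  assert (HW : W <= d * L).
  { replace W with (d * (W / d)) by (field; lra). apply Rmult_le_compat_l; [lra|].
    eapply Rle_trans; [apply Rmax_r | exact HLm]. }
  destruct (HA n HL0) as [A1 [A2 A3]]. fold L in A3.
  rewrite cond_exp_bridge by lia.
  set (h := (n - 1)%nat). set (a := (2 * Acut n - 2)%nat).
  replace (2 * n - 2)%nat with (2 * h)%nat by (unfold h; lia). set (k := (2 * h - a)%nat).
  assert (Hev : Nat.even k = true).
  { apply Nat.even_spec. exists (h - (Acut n - 1))%nat. unfold k, a. lia. }
  assert (HLn : 0 <= L) by (apply ln_nonneg; lra).
  assert (Hh : L - ln 2 <= ln (INR h)).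
  { unfold L. rewrite <- ln_quot by lra. apply ln_le_compat; [lra|].
    unfold h. rewrite minus_INR by lia. simpl. lra. }
  assert (Hh1 : 1 <= INR h) by (apply INR_ge_1; unfold h; lia).
  assert (Hk : ln (INR h) <= ln (INR k)) by (apply ln_le_compat; [lra | apply le_INR; unfold k, a, h; lia]).
  assert (Hk1 : INR h <= INR k) by (apply le_INR; unfold k, a, h; lia).
  assert (Hm : ln (INR (2 * h)) <= L + ln 2).
  { unfold L. rewrite Rplus_comm, <- ln_mult by lra. apply ln_le_compat.
    - rewrite mult_INR. simpl. lra.
    - rewrite mult_INR. replace (INR 2) with 2 by (simpl; ring). apply Rmult_le_compat_l; [lra|].
      apply le_INR; unfold h; lia. }
  assert (Hkm : ln (INR k) <= ln (INR (2 * h))) by (apply ln_le_compat; [lra | apply le_INR; unfold k; lia]).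
  assert (Ha : ln (INR a) <= ln 2 + d / c * L).
  { apply Rle_trans with (ln (2 * INR (Acut n))).
    - apply ln_le_compat; [apply lt_0_INR; unfold a; lia|].
      replace 2 with (INR 2) by (simpl; ring). rewrite <- mult_INR. apply le_INR. unfold a; lia.
    - rewrite ln_mult; [lra | lra | apply lt_0_INR; lia]. }
  assert (Hca : c * ln (INR a) <= c * ln 2 + d * L).
  { replace (c * ln 2 + d * L) with (c * (ln 2 + d / c * L)) by (field; lra).
    apply Rmult_le_compat_l; lra. }
  pose proof (HU h a ltac:(unfold a; lia) ltac:(unfold a, h; lia)) as U1.
  pose proof (HL (2 * h)%nat a ltac:(unfold h; lia) ltac:(unfold a; lia)
    ltac:(unfold a, h; lia) Hev) as U3.
  pose proof (HZ k ltac:(unfold k, a, h; lia) Hev) as U2.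
  pose proof (bridge_upper_uniform (fun _ => 0) k d ltac:(lra) ltac:(unfold k, a, h; lia)
    ltac:(intros; lra) 0%Z) as U4.
  fold C4 in U4. fold k in U1, U3.
  set (Nu := bridge (invsq lam (2 * h)) k 0) in *. set (De := bridge (fun _ => 0) k 0) in *.
  assert (HDe : 0 < De) by (now apply bridge_zero_pos).
  assert (HC4 : 0 < C4) by apply exp_pos.
  pose proof (Rle_abs (ln C1)). pose proof (Rle_abs (ln C4)).
  pose proof (Rle_abs (- ln C2)) as HA2. pose proof (Rle_abs (- ln C3)) as HA3.
  rewrite Rabs_Ropp in HA2, HA3.
  pose proof (Rabs_pos (ln C1)). pose proof (Rabs_pos (ln C2)).
  pose proof (Rabs_pos (ln C3)). pose proof (Rabs_pos (ln C4)).
  rewrite <- (exp_ln C1 HC1), <- exp_plus in U1. rewrite <- (exp_ln C2 HC2), <- exp_plus in U2.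
  rewrite <- (exp_ln C3 HC3), <- exp_plus in U3. rewrite <- (exp_ln C4 HC4), <- exp_plus in U4.
  assert (Hcd : d * ln 2 <= 1 / 2 * ln 2) by (apply Rmult_le_compat_r; lra).
  unfold Rpower. fold L.
  replace (- (alpha - 1) / 2 - eps) with (- c - eps) by (unfold c; field).
  replace (- (alpha - 1) / 2 + eps) with (- c + eps) by (unfold c; field).
  assert (HeL : 6 * d * L <= eps * L) by (apply Rmult_le_compat_r; lra).
  split; apply Rmult_le_reg_r with De; auto; unfold Rdiv; rewrite Rmult_assoc, Rinv_l, Rmult_1_r by lra.
  - eapply Rle_trans; [|exact U3]. eapply Rle_trans.
    { apply Rmult_le_compat_l; [left; apply exp_pos | exact U4]. }
    rewrite <- exp_plus. apply exp_le.
    assert (I1 : (c + 1 / 2 + 3 * d) * ln (INR (2 * h)) <= (c + 1 / 2 + 3 * d) * (L + ln 2))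
      by (apply Rmult_le_compat_l; lra).
    assert (I2 : (1 / 2 - d) * (L - ln 2) <= (1 / 2 - d) * ln (INR k))
      by (apply Rmult_le_compat_l; lra).
    assert (0 <= c * ln 2) by (apply Rmult_le_pos; lra).
    assert (0 <= d * ln 2) by (apply Rmult_le_pos; lra).
    unfold W in HW. lra.
  - eapply Rle_trans; [exact U1|]. eapply Rle_trans.
    2: { apply Rmult_le_compat_l; [left; apply exp_pos | exact U2]. }
    rewrite <- exp_plus. apply exp_le.
    assert (I1 : (c + 1 / 2 - 2 * d) * (L - ln 2) <= (c + 1 / 2 - 2 * d) * ln (INR h))
      by (apply Rmult_le_compat_l; lra).
    assert (I2 : (1 / 2 + 2 * d) * ln (INR k) <= (1 / 2 + 2 * d) * (L + ln 2))
      by (apply Rmult_le_compat_l; lra).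
    assert (0 <= c * ln 2) by (apply Rmult_le_pos; lra).
    assert (0 <= d * ln 2) by (apply Rmult_le_pos; lra).
    unfold W in HW. lra.
Qed.
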